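(* Let $\varepsilon>0$, $F\in C^1(\mathbb{R})$ and $a\in C(]0,1[\times[0,\infty)\times\mathbb{R}^4)$, and consider for $t_0\ge0$ the problem $$-\varepsilon u_{xxt}+u_{tt}-u_{xx}=F(u)-a(x,t,u,u_x,u_{xx},u_t)\,u_t,\quad x\in(0,1),\ t>t_0,\qquad u(0,t)=u(1,t)=0,$$ with $u(x,t_0)=u_0(x)$, $u_t(x,t_0)=u_1(x)$, $u_0(0)=u_0(1)=u_1(0)=u_1(1)=0$. Assume: $F(0)=0$ and there is a constant $K>0$ with $F'(s)\le K<3\pi^2/4$ for all $s$; $\nu:=\varepsilon\pi^2+\inf a>0$; and there exist $\tau\in[0,2[$ and constants $A>0$, $A'\ge0$ such that $a(x,t,\varphi,\varphi_x,\varphi_{xx},\psi)\le A\,[d(\varphi,\psi)]^{\tau}+A'$ for all $x,t$ and $(\varphi,\psi)\in\Gamma$. Then the null solution is exponential-asymptotically stable in the large.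
   Context: $\Gamma:=\{(\varphi,\psi):\varphi\in C^2([0,1]),\ \psi\in C([0,1]),\ \varphi(0)=\varphi(1)=\psi(0)=\psi(1)=0\}$, $d^2(\varphi,\psi):=\int_0^1(\varphi^2+\varphi_x^2+\varphi_{xx}^2+\psi^2)dx$. The null solution is exponential-asymptotically stable in the large if for every $\alpha>0$ there are constants $D(\alpha),C(\alpha)>0$ such that, for every $t_0\ge0$ and initial data with $d(u_0,u_1)\le\alpha$, the solution satisfies $d(u(\cdot,t),u_t(\cdot,t))\le D(\alpha)e^{-C(\alpha)(t-t_0)}d(u_0,u_1)$ for all $t\ge t_0$. *)

(* Defs.v *)
From Stdlib Require Import Reals Lra.
From Coquelicot Require Import Coquelicot.
Open Scope R_scope.

Definition cont_within {T : UniformSpace} (D : T -> Prop) (f : T -> R) (p : T) : Prop :=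
  filterlim f (within D (locally p)) (locally (f p)).

Definition unit_int (x : R) : Prop := 0 <= x <= 1.

(* Real power d^tau for d >= 0, with the usual convention 0^0 = 1, 0^tau = 0 for tau > 0. *)
Definition rpow (d tau : R) : R :=
  if Req_EM_T d 0 then (if Req_EM_T tau 0 then 1 else 0) else Rpower d tau.

Definition C2_closed01 (phi : R -> R) : Prop :=
  exists phi1 phi2 : R -> R,
    (forall x, 0 < x < 1 -> is_derive phi x (phi1 x) /\ is_derive phi1 x (phi2 x)) /\
    (forall x, unit_int x ->
       cont_within unit_int phi x /\ cont_within unit_int phi1 x /\
       cont_within unit_int phi2 x).

Definition C0_closed01 (psi : R -> R) : Prop :=
  forall x, unit_int x -> cont_within unit_int psi x.

Definition InGamma (phi psi : R -> R) : Prop :=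
  C2_closed01 phi /\ C0_closed01 psi /\
  phi 0 = 0 /\ phi 1 = 0 /\ psi 0 = 0 /\ psi 1 = 0.

Definition dGamma (phi psi : R -> R) : R :=
  sqrt (RInt (fun x => (phi x)^2 + (Derive phi x)^2 + (Derive (Derive phi) x)^2 + (psi x)^2) 0 1).

Definition a_dom (z : R * R * R * R * R * R) : Prop :=
  let '(x, t, _, _, _, _) := z in 0 < x < 1 /\ 0 <= t.

Definition uncurry6 (a : R -> R -> R -> R -> R -> R -> R) (z : R * R * R * R * R * R) : R :=
  let '(x, t, p, q, r, s) := z in a x t p q r s.

(* Classical solution of
     -eps u_xxt + u_tt - u_xx = F(u) - a(x,t,u,u_x,u_xx,u_t) u_t  on ]0,1[ x ]t0,oo[,
     u(0,t) = u(1,t) = 0,  u(x,t0) = u0(x),  u_t(x,t0) = u1(x).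
   u, u_x, u_xx, u_t are continuous on [0,1] x [t0,oo) (ut is the continuous extension
   of the time derivative), u_tt and u_xxt exist and are continuous in the interior. *)
Definition is_solution (eps : R) (F : R -> R) (a : R -> R -> R -> R -> R -> R -> R)
    (t0 : R) (u0 u1 : R -> R) (u ut : R -> R -> R) : Prop :=
  let Q := fun p : R * R => 0 <= fst p <= 1 /\ t0 <= snd p in
  let Qo := fun p : R * R => 0 < fst p < 1 /\ t0 < snd p in
  exists ux uxx utt uxxt : R -> R -> R,
    (forall x t, 0 < x < 1 -> t0 < t ->
       is_derive (fun y => u y t) x (ux x t) /\
       is_derive (fun y => ux y t) x (uxx x t) /\
       is_derive (fun s => u x s) t (ut x t) /\
       is_derive (fun s => ut x s) t (utt x t) /\
       is_derive (fun s => uxx x s) t (uxxt x t)) /\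
    (forall p, Q p ->
       cont_within Q (fun q => u (fst q) (snd q)) p /\
       cont_within Q (fun q => ux (fst q) (snd q)) p /\
       cont_within Q (fun q => uxx (fst q) (snd q)) p /\
       cont_within Q (fun q => ut (fst q) (snd q)) p) /\
    (forall p, Qo p ->
       cont_within Qo (fun q => utt (fst q) (snd q)) p /\
       cont_within Qo (fun q => uxxt (fst q) (snd q)) p) /\
    (forall x t, 0 < x < 1 -> t0 < t ->
       - eps * uxxt x t + utt x t - uxx x t
       = F (u x t) - a x t (u x t) (ux x t) (uxx x t) (ut x t) * ut x t) /\
    (forall t, t0 <= t -> u 0 t = 0 /\ u 1 t = 0) /\
    (forall x, unit_int x -> u x t0 = u0 x /\ ut x t0 = u1 x).

Definition exp_stable_in_large (eps : R) (F : R -> R) (a : R -> R -> R -> R -> R -> R -> R) : Prop :=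
  forall alpha, 0 < alpha ->
  exists D C, 0 < D /\ 0 < C /\
    forall (t0 : R) (u0 u1 : R -> R) (u ut : R -> R -> R),
      0 <= t0 -> InGamma u0 u1 -> dGamma u0 u1 <= alpha ->
      is_solution eps F a t0 u0 u1 u ut ->
      forall t, t0 <= t ->
        dGamma (fun x => u x t) (fun x => ut x t) <= D * exp (- C * (t - t0)) * dGamma u0 u1.

(* Main.v *)
(* With [w = u_t] and a parameter [g], the functional
   [V = int (eps u_xx - w)^2 / 2 + g w^2 / 2 + (1 + g) (u_x^2 / 2 - int_0^u F)]
   dissipates, provided that [g] is of the order of an upper bound of [a] along the solution:
   this compensates the term [eps a u_xx w]. If [d <= sigma] that bound is [A sigma^tau + A'],
   while [V] controls [d^2] and starts below [C (1 + g) alpha^2]. Since [tau < 2], [sigma] can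
   be chosen so that [C (1 + sigma^tau) alpha^2 < sigma^2]; then [d] never reaches [sigma] and
   [V] decays exponentially.

   Nothing is known about [u_tt] and [u_xxt] at [x = 0, 1], so [int w w_xx] cannot be
   integrated by parts directly. Instead one integrates first in time, at fixed [x]. With
   [p' = - k^2 - p^2] and [k < PI] close to [PI], one has
   [w w_xx <= (w w_x - p w^2)_x - k^2 w^2], and the time integral of the flux is
   [G' / 2 - p G] for [G(x) = int w^2 dt], a nonnegative function vanishing at both ends;
   by the mean value theorem [G' >= 0] at points close to 0 and [G' <= 0] at points close
   to 1, so the flux contributes with the good sign. *)
Require Import Defs.
From Stdlib Require Import Reals Lra Psatz.
From Coquelicot Require Import Coquelicot.
Open Scope R_scope.

(** * Calculus *)

(** Why this [V]: the equation reads [(eps u_xx - w)_t = - (u_xx + F(u) - a w)], so the first square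
    produces the damping [- eps u_xx^2]. The weight [1 + g] makes the terms [F(u) w] cancel and
    collects [u_xx w + u_x w_x] into the exact derivative [(u_x w)_x].

    The choice of constants threatens to be circular, as [g] depends on [sigma] and [V] on [g].
    Three facts prevent this. The lower bound of [V] by [d^2] does not depend on [g]. The upper
    bound of the initial [V] is linear in [1 + g] and uses a lower bound of [F'] on
    [[-alpha, alpha]] only; the bound on [[-sigma, sigma]] enters the decay rate alone. Finally
    [a^2] is estimated by a constant times [a + eps k^2], with a constant linear in the upper bound
    of [a], so that [g] grows like [sigma^tau]; a cruder [sigma^(2 tau)] would force [tau < 1].

    The derivative [u_xt] is not part of the notion of solution and has to be constructed, and
    [u_t = 0] on the lateral boundary has to be deduced from [u = 0] there. *)

Lemma locally_open_interval (l r x : R) (P : R -> Prop) :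
  l < x < r -> (forall y, l < y < r -> P y) -> locally x P.
Proof.
intros Hx HP.
assert (Hd : 0 < Rmin (x - l) (r - x)) by (apply Rmin_glb_lt; lra).
exists (mkposreal _ Hd); intros y Hy; apply HP.
change (Rabs (y - x) < Rmin (x - l) (r - x)) in Hy.
pose proof (Rmin_l (x - l) (r - x)); pose proof (Rmin_r (x - l) (r - x)).
apply Rabs_lt_between in Hy; lra.
Qed.

Lemma locally_gt (t0 t : R) (P : R -> Prop) :
  t0 < t -> (forall s, t0 < s -> P s) -> locally t P.
Proof.
intros Ht HP; apply (locally_open_interval t0 (t + 1)); [lra|].
intros s Hs; apply HP; lra.
Qed.

Lemma continuity_2d_pt_swap (f : R -> R -> R) (x t : R) :
  continuity_2d_pt f x t -> continuity_2d_pt (fun s y => f y s) t x.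
Proof.
intros Hf e; destruct (Hf e) as [d Hd]; exists d; intros u v Hu Hv.
now apply Hd.
Qed.

Lemma continuity_2d_pt_fst (f : R -> R -> R) (x t : R) :
  continuity_2d_pt f x t -> continuous (fun y => f y t) x.
Proof.
intros Hf; apply continuity_pt_filterlim, continuity_pt_locally.
intros e; destruct (Hf e) as [d Hd]; exists d; intros y Hy.
apply Hd; [exact Hy|]; rewrite Rminus_diag, Rabs_R0; apply cond_pos.
Qed.

Lemma continuity_2d_pt_snd (f : R -> R -> R) (x t : R) :
  continuity_2d_pt f x t -> continuous (f x) t.
Proof.
intros Hf; apply (continuity_2d_pt_fst (fun s y => f y s)).
now apply continuity_2d_pt_swap.
Qed.

Lemma continuity_2d_pt_comp1 (g : R -> R) (f : R -> R -> R) (x t : R) :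
  continuous g (f x t) -> continuity_2d_pt f x t ->
  continuity_2d_pt (fun y s => g (f y s)) x t.
Proof.
intros Hg Hf; apply continuity_1d_2d_pt_comp; [|exact Hf].
now apply continuity_pt_filterlim.
Qed.

Lemma continuous_small_near (f : R -> R) (x e : R) :
  0 < e -> continuous f x ->
  exists d, 0 < d /\ forall y, Rabs (y - x) < d -> Rabs (f y - f x) < e.
Proof.
intros He Hf; apply continuity_pt_filterlim in Hf.
destruct (proj1 (continuity_pt_locally f x) Hf (mkposreal e He)) as [d Hd].
exists d; split; [apply cond_pos|exact Hd].
Qed.

Lemma continuous_le_closure (f : R -> R) (a b x c : R) :
  a < b -> a <= x <= b -> continuous f x -> (forall y, a < y < b -> f y <= c) -> f x <= c.
Proof.
intros Hab Hx Hf Hle; destruct (Rle_lt_dec (f x) c) as [H|H]; [exact H|].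
destruct (continuous_small_near f x (f x - c) ltac:(lra) Hf) as (d & Hd0 & Hd).
pose (l := Rmin (1 / 2) (d / (b - a))).
assert (0 < l) by (apply Rmin_glb_lt; [lra|apply Rdiv_lt_0_compat; lra]).
assert (l <= 1 / 2 /\ l <= d / (b - a)) as [Hl1 Hl2] by (split; [apply Rmin_l|apply Rmin_r]).
(* Moving [x] towards the midpoint by the fraction [l] lands strictly inside the interval even if
   [x] is an endpoint, at distance at most [l (b - a) / 2]. *)
pose (y := x + l * ((a + b) / 2 - x)).
assert (Hy : a < y < b) by (unfold y; split; nra).
assert (Hld : l * (b - a) <= d).
{ apply Rle_trans with (d / (b - a) * (b - a)); [nra|right; field; lra]. }
assert (Hyx : Rabs (y - x) < d) by (apply Rabs_lt_between; unfold y; split; nra).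
apply Hd, Rabs_lt_between in Hyx; specialize (Hle y Hy); lra.
Qed.

Lemma continuous_eq_closure (f : R -> R) (a b x c : R) :
  a < b -> a <= x <= b -> continuous f x -> (forall y, a < y < b -> f y = c) -> f x = c.
Proof.
intros Hab Hx Hf He; apply Rle_antisym.
- apply (continuous_le_closure f a b); auto; intros y Hy; rewrite He; auto; lra.
- apply Ropp_le_cancel, (continuous_le_closure (fun y => - f y) a b); auto.
  + now apply (continuous_opp (V := R_NormedModule) f).
  + intros y Hy; rewrite He; auto; lra.
Qed.

Lemma continuous_RInt_param (f : R -> R -> R) (a b t : R) :
  a <= b ->
  locally t (fun s => forall x, a <= x <= b -> continuity_2d_pt f x s) ->
  continuous (fun s => RInt (fun x => f x s) a b) t.
Proof.
intros Hab Hf.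
assert (Hex : forall s, (forall x, a <= x <= b -> continuity_2d_pt f x s) ->
  ex_RInt (fun x => f x s) a b).
{ intros s Hs; apply (ex_RInt_continuous (V := R_CompleteNormedModule)); intros x Hx.
  rewrite Rmin_left, Rmax_right in Hx by lra.
  now apply (continuity_2d_pt_fst f), Hs. }
apply continuity_pt_filterlim, continuity_pt_locally; intros e.
assert (Hft := locally_singleton _ _ Hf).
assert (He : 0 < e / (b - a + 1)) by (apply Rdiv_lt_0_compat; [apply cond_pos|lra]).
destruct (uniform_continuity_2d_1d f a b t Hft (mkposreal _ He)) as [d Hd].
destruct Hf as [d' Hd'].
assert (Hm : 0 < Rmin d d') by (apply Rmin_glb_lt; apply cond_pos).
exists (mkposreal _ Hm); intros s Hs.
change (Rabs (s - t) < Rmin d d') in Hs.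
pose proof (Rmin_l d d'); pose proof (Rmin_r d d').
assert (Hexs : ex_RInt (fun x => f x s) a b) by (apply Hex, Hd'; change (Rabs (s - t) < d'); lra).
assert (Hext : ex_RInt (fun x => f x t) a b) by (now apply Hex).
change (RInt (fun x => f x s) a b - RInt (fun x => f x t) a b) with
  (minus (RInt (fun x => f x s) a b) (RInt (fun x => f x t) a b)).
rewrite <- RInt_minus by assumption.
apply Rle_lt_trans with ((b - a) * (e / (b - a + 1))).
{ apply abs_RInt_le_const; [exact Hab|now apply (ex_RInt_minus (V := R_NormedModule))|].
  intros x Hx; left; apply (Hd x t x s); try exact Hx.
  - pose proof (cond_pos d); lra.
  - assert (Rabs (s - t) < d) as H1 by lra; apply Rabs_lt_between in H1; lra.
  - rewrite Rminus_diag, Rabs_R0; apply cond_pos. }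
apply Rlt_le_trans with ((b - a + 1) * (e / (b - a + 1))).
- apply Rmult_lt_compat_r; [exact He|lra].
- right; field; lra.
Qed.

Lemma is_derive_RInt_param_box (f f' : R -> R -> R) (a b l r t : R) :
  a <= b -> l < t < r ->
  (forall x s, a <= x <= b -> l < s < r -> continuous (fun y => f y s) x) ->
  (forall x s, a <= x <= b -> l < s < r -> is_derive (f x) s (f' x s)) ->
  (forall x, a <= x <= b -> continuity_2d_pt f' x t) ->
  (forall x, a <= x <= b -> locally_2d (fun y s => is_derive (f y) s (f' y s)) x t) ->
  is_derive (fun s => RInt (fun x => f x s) a b) t (RInt (fun x => f' x t) a b).
Proof.
intros Hab Ht Hc Hd Hc' Hloc.
replace (RInt (fun x => f' x t) a b)
  with (RInt (fun x => Derive (fun s => f x s) t) a b).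
- apply (is_derive_RInt_param (fun s x => f x s)); rewrite ?Rmin_left, ?Rmax_right by lra.
  + apply (locally_open_interval l r); [exact Ht|]; intros s Hs x Hx.
    exists (f' x s); apply (Hd x s); assumption.
  + intros x Hx.
    apply continuity_2d_pt_ext_loc with (f := fun s y => f' y s).
    * destruct (Hloc x Hx) as [d Hdd]; exists d; intros u v Hu Hv; symmetry.
      apply is_derive_unique; now apply Hdd.
    * apply continuity_2d_pt_swap; now apply Hc'.
  + apply (locally_open_interval l r); [exact Ht|]; intros s Hs.
    apply (ex_RInt_continuous (V := R_CompleteNormedModule)); intros x Hx.
    rewrite Rmin_left, Rmax_right in Hx by lra; now apply Hc.
- apply RInt_ext; intros x Hx; rewrite Rmin_left, Rmax_right in Hx by lra.
  apply is_derive_unique, Hd; lra.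
Qed.

Definition clamp (a b x : R) : R := Rmax a (Rmin b x).

Lemma clamp_id (a b x : R) : a <= x <= b -> clamp a b x = x.
Proof. intros Hx; unfold clamp; rewrite Rmin_right, Rmax_right; lra. Qed.

Lemma clamp_bounds (a b x : R) : a <= b -> a <= clamp a b x <= b.
Proof.
intros Hab; unfold clamp; split; [apply Rmax_l|].
apply Rmax_lub; [exact Hab|apply Rmin_l].
Qed.

Lemma continuous_Rmax_const (a x : R) : continuous (Rmax a) x.
Proof.
apply continuity_pt_filterlim, continuity_pt_locally; intros e; exists e; intros y Hy.
change (Rabs (y - x) < e) in Hy; apply Rabs_lt_between in Hy.
apply Rabs_lt_between; unfold Rmax; repeat destruct Rle_dec; lra.
Qed.

Lemma continuous_clamp (a b x : R) : continuous (clamp a b) x.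
Proof.
apply continuity_pt_filterlim, continuity_pt_locally; intros e; exists e; intros y Hy.
change (Rabs (y - x) < e) in Hy; apply Rabs_lt_between in Hy.
apply Rabs_lt_between; unfold clamp, Rmax, Rmin; repeat destruct Rle_dec; lra.
Qed.

(** Functions frozen outside a strip need not have two-sided derivatives at its edges, hence a
    fundamental theorem with differentiability in the open interval only. Composing [g] with [clamp]
    gives a function continuous on the whole line, whose primitive differs from [f] by a
    constant. *)
Lemma is_RInt_derive_interior (f g : R -> R) (a b : R) :
  a <= b ->
  (forall x, a < x < b -> is_derive f x (g x)) ->
  (forall x, a <= x <= b -> continuous f x) ->
  (forall x, a <= x <= b -> continuous g x) ->
  RInt g a b = f b - f a.
Proof.
intros Hab Hd Hf Hg.
pose (h := fun x => g (clamp a b x)).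
assert (Hh : forall x, continuous h x).
{ intros x; apply (continuous_comp (clamp a b) g); [apply continuous_clamp|].
  now apply Hg, clamp_bounds. }
assert (HI : forall x, is_derive (RInt h a) x (h x)).
{ intros x; apply (is_derive_RInt (V := R_NormedModule) h (RInt h a) a); [|apply Hh].
  apply filter_forall; intros y; apply (RInt_correct (V := R_CompleteNormedModule)).
  apply (ex_RInt_continuous (V := R_CompleteNormedModule)); intros z _; apply Hh. }
replace (RInt g a b) with (RInt h a b).
2:{ apply RInt_ext; intros x Hx; rewrite Rmin_left, Rmax_right in Hx by lra.
    unfold h; rewrite clamp_id; [reflexivity|lra]. }
destruct (MVT_gen (fun x => f x - RInt h a x) a b (fun _ => 0)) as (c & _ & E);
  rewrite ?Rmin_left, ?Rmax_right by lra.
- intros x Hx; replace 0 with (minus (g x) (h x)).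
  + apply (is_derive_minus (V := R_NormedModule) f (RInt h a)); [now apply Hd|apply HI].
  + unfold h; rewrite clamp_id by lra; apply Rminus_diag.
- intros x Hx; apply continuity_pt_filterlim.
  apply (continuous_minus (V := R_NormedModule) f (RInt h a)); [now apply Hf|].
  apply (ex_derive_continuous (V := R_NormedModule)); eexists; apply HI.
- rewrite RInt_point in E; unfold zero in E; simpl in E; lra.
Qed.

Lemma ex_RInt_cont (f : R -> R) (a b : R) :
  a <= b -> (forall x, a <= x <= b -> continuous f x) -> ex_RInt f a b.
Proof.
intros Hab Hf; apply (ex_RInt_continuous (V := R_CompleteNormedModule)); intros x Hx.
rewrite Rmin_left, Rmax_right in Hx by lra; now apply Hf.
Qed.

Lemma is_derive_RInt_upper (f : R -> R) (a x : R) :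
  (forall y, continuous f y) -> is_derive (RInt f a) x (f x).
Proof.
intros Hf; apply (is_derive_RInt (V := R_NormedModule) f (RInt f a) a); [|apply Hf].
apply filter_forall; intros y; apply (RInt_correct (V := R_CompleteNormedModule)).
apply (ex_RInt_continuous (V := R_CompleteNormedModule)); intros z _; apply Hf.
Qed.

(** Both sides vanish at [t = s] and have the same derivative in [t]. *)
Lemma fubini_rectangle (f : R -> R -> R) (a b s t : R) :
  a <= b -> s <= t -> (forall x r, continuity_2d_pt f x r) ->
  RInt (fun x => RInt (f x) s t) a b = RInt (fun r => RInt (fun x => f x r) a b) s t.
Proof.
intros Hab Hst Hf.
assert (Hd : forall r, is_derive (fun r => RInt (fun x => RInt (f x) s r) a b) r
  (RInt (fun x => f x r) a b)).
{ intros r.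
  apply (is_derive_RInt_param_box (fun x r => RInt (f x) s r) f a b (r - 1) (r + 1));
    [exact Hab|lra|..].
  - intros x q _ _.
    (* The two-sided derivative is taken at every real [r], so continuity in [x] is also required
       when the bounds of the inner integral are reversed. *)
    destruct (Rle_lt_dec s q) as [Hq|Hq].
    + apply (continuous_RInt_param (fun z y => f y z) s q x Hq).
      apply filter_forall; intros y z _; apply continuity_2d_pt_swap, Hf.
    + apply continuous_ext with (fun y => - RInt (f y) q s).
      { intros y; apply (opp_RInt_swap (f y) q s).
        apply ex_RInt_cont; [lra|]; intros; apply (continuity_2d_pt_snd f), Hf. }
      apply (continuous_opp (V := R_NormedModule)).
      apply (continuous_RInt_param (fun z y => f y z) q s x (Rlt_le _ _ Hq)).
      apply filter_forall; intros y z _; apply continuity_2d_pt_swap, Hf.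
  - intros x q _ _; apply is_derive_RInt_upper; intros; apply (continuity_2d_pt_snd f), Hf.
  - intros; apply Hf.
  - intros x _; exists (mkposreal 1 Rlt_0_1); intros y q _ _.
    apply is_derive_RInt_upper; intros; apply (continuity_2d_pt_snd f), Hf. }
symmetry.
replace (RInt (fun x => RInt (f x) s t) a b)
  with (RInt (fun x => RInt (f x) s t) a b - RInt (fun x => RInt (f x) s s) a b).
- apply (is_RInt_derive_interior (fun r => RInt (fun x => RInt (f x) s r) a b)); auto.
  + intros x _; apply (ex_derive_continuous (V := R_NormedModule)); eexists; apply Hd.
  + intros x _; apply continuous_RInt_param; [exact Hab|].
    apply filter_forall; intros; apply Hf.
- rewrite (RInt_ext (fun x => RInt (f x) s s) (fun _ => 0)).
  + rewrite RInt_const; unfold scal; simpl; unfold mult; simpl; ring.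
  + intros; apply (RInt_point (V := R_CompleteNormedModule)).
Qed.

(** The hypothesis is in integral form because [V] is only known to be continuous. It omits [s = a]
    because the energy inequality rests on time derivatives, which exist only after the initial
    time; continuity recovers this case. *)
Lemma gronwall_backward (V : R -> R) (a b l : R) :
  0 < l -> a <= b -> (forall t, continuous V t) ->
  (forall s, a < s -> s <= b -> V b + l * RInt V s b <= V s) ->
  V b <= exp (- l * (b - a)) * V a.
Proof.
intros Hl Hab HV H.
destruct (Req_dec a b) as [<-|Hne].
{ replace (- l * (a - a)) with 0 by ring; rewrite exp_0; lra. }
(* [Y] dominates [V b / l] and satisfies [Y' = - V <= - l Y]. *)
pose (Y := fun s => V b / l + RInt V s b).
assert (HY : forall s, is_derive Y s (- V s)).
{ intros s; unfold Y.
  replace (- V s) with (plus 0 (opp (V s))) by (unfold plus, opp; simpl; ring).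
  apply (is_derive_plus (V := R_NormedModule)); [apply (is_derive_const (V := R_NormedModule))|].
  apply (is_derive_RInt' (V := R_NormedModule) V (fun s => RInt V s b) s b); [|apply HV].
  apply filter_forall; intros y; apply (RInt_correct (V := R_CompleteNormedModule)).
  apply (ex_RInt_continuous (V := R_CompleteNormedModule)); intros z _; apply HV. }
assert (HYV : forall s, a < s <= b -> l * Y s <= V s).
{ intros s Hs; apply Rle_trans with (V b + l * RInt V s b); [|now apply H].
  right; unfold Y; field; lra. }
assert (HE : forall s, is_derive (fun s => exp (l * s) * Y s) s (exp (l * s) * (l * Y s - V s))).
{ intros s; replace (exp (l * s) * (l * Y s - V s))
    with (plus (mult (l * exp (l * s)) (Y s)) (mult (exp (l * s)) (- V s)))
    by (unfold plus, mult; simpl; ring).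
  apply (is_derive_mult (fun s => exp (l * s)) Y); [|apply HY|intros; apply Rmult_comm].
  auto_derive; [exact I|ring]. }
destruct (MVT_gen (fun s => exp (l * s) * Y s) a b
  (fun s => exp (l * s) * (l * Y s - V s))) as (c & Hc & E).
- intros x _; apply HE.
- intros x _; apply continuity_pt_filterlim.
  apply (ex_derive_continuous (V := R_NormedModule) (fun s => exp (l * s) * Y s)).
  eexists; apply HE.
- rewrite Rmin_left, Rmax_right in Hc by lra.
  assert (HYVa : l * Y a - V a <= 0).
  { apply (continuous_le_closure (fun s => l * Y s - V s) a b); [lra|lra| |].
    - apply (continuous_minus (V := R_NormedModule)); [|apply HV].
      apply (continuous_mult (K := R_AbsRing)); [apply continuous_const|].
      apply (ex_derive_continuous (V := R_NormedModule)); eexists; apply HY.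
    - intros x Hx; specialize (HYV x); lra. }
  assert (HYVc : l * Y c - V c <= 0).
  { destruct (Req_dec a c) as [<-|]; [exact HYVa|]. specialize (HYV c); lra. }
  pose proof (exp_pos (l * c)).
  assert (Hexp : exp (l * b) * (V b / l) <= exp (l * a) * Y a).
  { replace (V b / l) with (Y b); [|unfold Y; rewrite RInt_point; unfold zero; simpl; ring].
    assert (0 <= exp (l * c) * (V c - l * Y c)) by (apply Rmult_le_pos; lra). nra. }
  replace (- l * (b - a)) with (l * a + - (l * b)) by ring.
  rewrite exp_plus, exp_Ropp.
  pose proof (exp_pos (l * b)); pose proof (exp_pos (l * a)).
  apply Rmult_le_reg_l with (exp (l * b)); [assumption|].
  replace (exp (l * b) * (exp (l * a) * / exp (l * b) * V a)) with (exp (l * a) * V a)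
    by (field; lra).
  replace (exp (l * b) * V b) with (l * (exp (l * b) * (V b / l))) by (field; lra).
  nra.
Qed.

(** Continuous induction: at the supremum [m] of the times up to which [d <= c], continuity gives
    [d m <= c], the hypothesis makes this strict, and continuity carries the bound beyond [m] unless
    [m = t]. *)
Lemma continuous_bootstrap (d : R -> R) (a c : R) :
  (forall t, continuous d t) -> d a < c ->
  (forall t, a <= t -> (forall s, a <= s <= t -> d s <= c) -> d t < c) ->
  forall t, a <= t -> d t < c.
Proof.
intros Hd Ha Hstep t Ht.
apply Hstep; [exact Ht|].
pose (E := fun r => a <= r <= t /\ forall s, a <= s <= r -> d s <= c).
assert (HEa : E a) by (split; [lra|]; intros s Hs; replace s with a by lra; lra).
destruct (completeness E) as [m [Hub Hlub]].
{ exists t; intros r [Hr _]; lra. }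
{ now exists a. }
assert (Ham : a <= m <= t).
{ split; [now apply Hub|]; apply Hlub; intros r [Hr _]; lra. }
assert (Hlt : forall s, a <= s < m -> d s <= c).
{ intros s Hs; destruct (Rle_lt_dec (d s) c) as [H|H]; [exact H|].
  assert (m <= s); [|lra].
  apply Hlub; intros r [Hr1 Hr2]; destruct (Rle_lt_dec r s) as [H'|H']; [exact H'|].
  specialize (Hr2 s); lra. }
assert (Hm : d m <= c).
{ destruct (Req_dec a m) as [<-|Hne]; [lra|].
  apply (continuous_le_closure d a m); [lra|lra|apply Hd|]; intros y Hy; apply Hlt; lra. }
assert (Hle : forall s, a <= s <= m -> d s <= c).
{ intros s Hs; destruct (Req_dec s m) as [->|]; [exact Hm|apply Hlt; lra]. }
assert (Hm' : d m < c) by (apply Hstep; [lra|exact Hle]).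
destruct (Req_dec m t) as [<-|Hne]; [exact Hle|].
assert (Hcm := proj2 (continuity_pt_filterlim _ _) (Hd m)).
destruct (proj1 (continuity_pt_locally d m) Hcm (mkposreal (c - d m) ltac:(lra))) as [e He].
simpl in He; pose proof (cond_pos e).
pose (h := Rmin (e / 2) (t - m)).
assert (0 < h) by (apply Rmin_glb_lt; lra).
assert (h <= e / 2 /\ h <= t - m) as [He1 He2] by (split; [apply Rmin_l|apply Rmin_r]).
assert (m + h <= m); [|lra].
apply Hub; split; [lra|]; intros s Hs.
destruct (Rle_lt_dec s m) as [Hsm|Hsm]; [apply Hle; lra|].
assert (Hb : ball m e s) by (change (Rabs (s - m) < e); rewrite Rabs_pos_eq; lra).
apply He, Rabs_lt_between in Hb; lra.
Qed.

Lemma mvt_open (f g : R -> R) (a b : R) :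
  a < b -> (forall x, a < x < b -> is_derive f x (g x)) ->
  (forall x, a <= x <= b -> continuous f x) ->
  exists c, a < c < b /\ f b - f a = g c * (b - a).
Proof.
intros Hab Hd Hc.
assert (pf : forall c, a < c < b -> derivable_pt f c).
{ intros c H; exists (g c); apply is_derive_Reals, Hd, H. }
destruct (MVT f id a b pf (fun c _ => derivable_pt_id c) Hab) as (c & P & E).
- intros c H; apply continuity_pt_filterlim, Hc, H.
- intros c _; apply continuity_pt_id.
- exists c; split; [exact P|].
  rewrite derive_pt_id in E; unfold id in E.
  assert (E2 : derive_pt f c (pf c P) = g c).
  { apply derive_pt_eq, is_derive_Reals, Hd, P. }
  rewrite E2 in E; lra.
Qed.

(* Nothing is assumed on [G'] near the endpoints: [G >= 0 = G 0 = G 1] and the mean value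
   theorem give points [a -> 0], [b -> 1] with [G' a >= 0 >= G' b]. *)
Lemma RInt_le_0_of_flux (G G' N m r : R -> R) :
  (forall x, continuous G x) -> (forall x, 0 <= G x) -> G 0 = 0 -> G 1 = 0 ->
  (forall x, 0 < x < 1 -> is_derive G x (G' x)) ->
  (forall x, 0 <= x <= 1 -> continuous N x) -> N 0 = 0 -> N 1 = 0 ->
  (forall x, 0 < x < 1 -> is_derive (fun y => G' y + N y) x (m x)) ->
  (forall x, continuous r x) -> (forall x, 0 < x < 1 -> r x <= m x) ->
  RInt r 0 1 <= 0.
Proof.
intros HGc HGp HG0 HG1 HG' HNc HN0 HN1 Hm Hr Hrm.
destruct (Rle_lt_dec (RInt r 0 1) 0) as [H|HI]; [exact H|exfalso].
set (I := RInt r 0 1) in *.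
assert (HD : forall x, is_derive (RInt r 0) x (r x)) by (intros; now apply is_derive_RInt_upper).
assert (HDc : forall x, continuous (RInt r 0) x).
{ intros x; apply (ex_derive_continuous (V := R_NormedModule)); eexists; apply HD. }
assert (HR0 : RInt r 0 0 = 0) by apply (RInt_point (V := R_CompleteNormedModule)).
(* Four errors below [I / 8] give the contradiction: the integral of [r] over [[a, b]] exceeds
   [3 I / 4], while [N b - N a] stays below [I / 4]. *)
assert (He : 0 < I / 8) by lra.
destruct (continuous_small_near _ 0 _ He (HDc 0)) as (d1 & Hd1 & Hd1').
destruct (continuous_small_near _ 1 _ He (HDc 1)) as (d2 & Hd2 & Hd2').
destruct (continuous_small_near _ 0 _ He (HNc 0 ltac:(lra))) as (d3 & Hd3 & Hd3').
destruct (continuous_small_near _ 1 _ He (HNc 1 ltac:(lra))) as (d4 & Hd4 & Hd4').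
pose (h := Rmin (1 / 2) (Rmin (Rmin d1 d2) (Rmin d3 d4) / 2)).
assert (Hh : 0 < h) by (unfold h; repeat apply Rmin_glb_lt; try lra;
  apply Rdiv_lt_0_compat; [repeat apply Rmin_glb_lt; lra|lra]).
pose proof (Rmin_l (1 / 2) (Rmin (Rmin d1 d2) (Rmin d3 d4) / 2)) as Hh1.
pose proof (Rmin_r (1 / 2) (Rmin (Rmin d1 d2) (Rmin d3 d4) / 2)) as Hh2.
fold h in Hh1, Hh2.
pose proof (Rmin_l (Rmin d1 d2) (Rmin d3 d4)); pose proof (Rmin_r (Rmin d1 d2) (Rmin d3 d4)).
pose proof (Rmin_l d1 d2); pose proof (Rmin_r d1 d2);
pose proof (Rmin_l d3 d4); pose proof (Rmin_r d3 d4).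
destruct (mvt_open G G' 0 h Hh) as (a & Ha & Ea);
  [intros; apply HG'; lra|intros; apply HGc|].
destruct (mvt_open G G' (1 - h) 1) as (b & Hb & Eb);
  [lra|intros; apply HG'; lra|intros; apply HGc|].
assert (HGa : 0 <= G' a) by (pose proof (HGp h); nra).
assert (HGb : G' b <= 0) by (pose proof (HGp (1 - h)); nra).
(* [m] is a mere pointwise derivative, not known to be integrable, so it is compared with [r]
   through the mean value theorem. *)
assert (Hab : RInt r 0 b - RInt r 0 a <= (G' b + N b) - (G' a + N a)).
{ assert (Hder : forall x, a <= x <= b ->
    is_derive (fun y => (G' y + N y) - RInt r 0 y) x (m x - r x)).
  { intros x Hx; apply (is_derive_minus (V := R_NormedModule) (fun y => G' y + N y));
      [apply Hm; lra|apply HD]. }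
  destruct (mvt_open (fun y => (G' y + N y) - RInt r 0 y) (fun x => m x - r x) a b)
    as (c & Hc & E); [lra|intros; apply Hder; lra| |].
  - intros x Hx; apply (ex_derive_continuous (V := R_NormedModule)); eexists; now apply Hder.
  - assert (r c <= m c) by (apply Hrm; lra). nra. }
specialize (Hd1' a); specialize (Hd2' b); specialize (Hd3' a); specialize (Hd4' b).
rewrite Rminus_0_r, Rabs_pos_eq in Hd1', Hd3' by lra.
rewrite (Rabs_left (b - 1)) in Hd2', Hd4' by lra.
rewrite HR0, Rminus_0_r in Hd1'; rewrite HN0, Rminus_0_r in Hd3'; rewrite HN1, Rminus_0_r in Hd4'.
fold I in Hd2'.
specialize (Hd1' ltac:(lra)); specialize (Hd2' ltac:(lra));
specialize (Hd3' ltac:(lra)); specialize (Hd4' ltac:(lra)).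
apply Rabs_lt_between in Hd1', Hd2', Hd3', Hd4'; lra.
Qed.

(** * Continuity, derivative and integral rules for real-valued functions *)

Ltac cont2 :=
  repeat first
    [ simple apply continuity_2d_pt_plus | simple apply continuity_2d_pt_minus
    | simple apply continuity_2d_pt_mult | simple apply continuity_2d_pt_opp
    | simple apply continuity_2d_pt_const ].

Lemma continuous_Rplus (f g : R -> R) (x : R) :
  continuous f x -> continuous g x -> continuous (fun y => f y + g y) x.
Proof. apply (continuous_plus (V := R_NormedModule) f g). Qed.

Lemma continuous_Rminus (f g : R -> R) (x : R) :
  continuous f x -> continuous g x -> continuous (fun y => f y - g y) x.
Proof. apply (continuous_minus (V := R_NormedModule) f g). Qed.

Lemma continuous_Rmult (f g : R -> R) (x : R) :
  continuous f x -> continuous g x -> continuous (fun y => f y * g y) x.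
Proof. apply (continuous_mult (K := R_AbsRing) f g). Qed.

Lemma continuous_Ropp (f : R -> R) (x : R) :
  continuous f x -> continuous (fun y => - f y) x.
Proof. apply (continuous_opp (V := R_NormedModule) f). Qed.

Lemma continuous_Rconst (c x : R) : continuous (fun _ : R => c) x.
Proof. apply continuous_const. Qed.

Ltac cont1 :=
  repeat first
    [ simple apply continuous_Rconst | simple apply continuous_Rplus
    | simple apply continuous_Rminus | simple apply continuous_Rmult
    | simple apply continuous_Ropp ].

Lemma is_derive_continuous (f : R -> R) (x l : R) : is_derive f x l -> continuous f x.
Proof. intros Hf; apply (ex_derive_continuous (V := R_NormedModule)); now exists l. Qed.

Lemma is_derive_Rmult (f g : R -> R) (x f' g' : R) :
  is_derive f x f' -> is_derive g x g' ->
  is_derive (fun y => f y * g y) x (f' * g x + f x * g').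
Proof. intros Hf Hg; apply (is_derive_mult f g x f' g' Hf Hg); intros; apply Rmult_comm. Qed.

Lemma is_derive_Rplus (f g : R -> R) (x f' g' : R) :
  is_derive f x f' -> is_derive g x g' -> is_derive (fun y => f y + g y) x (f' + g').
Proof. apply (is_derive_plus (V := R_NormedModule) f g). Qed.

Lemma is_derive_Rminus (f g : R -> R) (x f' g' : R) :
  is_derive f x f' -> is_derive g x g' -> is_derive (fun y => f y - g y) x (f' - g').
Proof. apply (is_derive_minus (V := R_NormedModule) f g). Qed.

Lemma is_derive_Rscal (f : R -> R) (c x f' : R) :
  is_derive f x f' -> is_derive (fun y => c * f y) x (c * f').
Proof. apply (is_derive_scal f x c f'). Qed.

Lemma is_derive_Rcomp (f g : R -> R) (x f' g' : R) :
  is_derive f (g x) f' -> is_derive g x g' -> is_derive (fun y => f (g y)) x (f' * g').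
Proof.
intros Hf Hg; rewrite Rmult_comm.
apply (is_derive_comp (V := R_NormedModule) f g x f' g' Hf Hg).
Qed.

Lemma RInt_Rscal (f : R -> R) (c a b : R) :
  ex_RInt f a b -> RInt (fun x => c * f x) a b = c * RInt f a b.
Proof. apply (RInt_scal (V := R_CompleteNormedModule) f a b c). Qed.

Lemma RInt_Rplus (f g : R -> R) (a b : R) :
  ex_RInt f a b -> ex_RInt g a b ->
  RInt (fun x => f x + g x) a b = RInt f a b + RInt g a b.
Proof. apply (RInt_plus (V := R_CompleteNormedModule) f g a b). Qed.

Lemma RInt_Rminus (f g : R -> R) (a b : R) :
  ex_RInt f a b -> ex_RInt g a b ->
  RInt (fun x => f x - g x) a b = RInt f a b - RInt g a b.
Proof. apply (RInt_minus (V := R_CompleteNormedModule) f g a b). Qed.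

Ltac exr := apply ex_RInt_cont; [lra|intros; cont1; auto].

(** * Poincare inequalities *)

Section Slice.

Variables (p : R -> R) (k : R) (u v w : R -> R).
Hypothesis (k_pos : 0 < k).
Hypothesis (p_der : forall x, 0 <= x <= 1 -> is_derive p x (- (k * k + p x * p x))).
Hypothesis (u_cont : forall x, continuous u x).
Hypothesis (v_cont : forall x, continuous v x).
Hypothesis (w_cont : forall x, continuous w x).
Hypothesis (u_der : forall x, 0 < x < 1 -> is_derive u x (v x)).
Hypothesis (v_der : forall x, 0 < x < 1 -> is_derive v x (w x)).
Hypothesis (u_0 : u 0 = 0).
Hypothesis (u_1 : u 1 = 0).

(* [p] is the logarithmic derivative of a positive solution of [y'' + k^2 y = 0], so that
   [v^2 - k^2 u^2 - (p u^2)' = (v - p u)^2]. *)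
Lemma poincare : k * k * RInt (fun x => u x * u x) 0 1 <= RInt (fun x => v x * v x) 0 1.
Proof.
assert (pc : forall x, 0 <= x <= 1 -> continuous p x).
{ intros x Hx; eapply is_derive_continuous, p_der, Hx. }
assert (E := is_RInt_derive_interior (fun x => p x * (u x * u x))
  (fun x => - (k * k + p x * p x) * (u x * u x) + p x * (v x * u x + u x * v x))
  0 1 Rle_0_1).
cbv beta in E; rewrite u_0, u_1 in E.
replace (p 1 * (0 * 0) - p 0 * (0 * 0)) with 0 in E by ring.
rewrite <- RInt_Rscal by exr.
apply Rminus_le_0; rewrite <- RInt_Rminus by exr.
refine (Rle_trans _ _ _ (Req_le _ _ (eq_sym (E _ _ _))) _).
4: apply RInt_le; [lra|exr|exr|].
- intros x Hx; apply (is_derive_Rmult p (fun y => u y * u y)); [apply p_der; lra|].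
  apply (is_derive_Rmult u u); auto.
- intros; cont1; auto.
- intros; cont1; auto.
- intros x Hx.
  pose proof (Rle_0_sqr (v x - p x * u x)) as Hsq; unfold Rsqr in Hsq; nra.
Qed.

(** The boundary terms [f (u x) * v x] vanish because [f 0 = 0], whatever [v] is at the endpoints.
    With [f = F] this handles the source term, with the identity it gives the Poincare inequality
    for [v]. *)
Lemma RInt_by_parts_slice (f f' : R -> R) :
  (forall z, is_derive f z (f' z)) -> (forall z, continuous f' z) -> f 0 = 0 ->
  RInt (fun x => - (w x * f (u x))) 0 1 = RInt (fun x => f' (u x) * (v x * v x)) 0 1.
Proof.
intros Hf Hf' Hf0.
assert (fc : forall x, continuous (fun y => f (u y)) x).
{ intros x; apply (continuous_comp u f); [apply u_cont|].
  eapply is_derive_continuous, Hf. }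
assert (fc' : forall x, continuous (fun y => f' (u y)) x).
{ intros x; apply (continuous_comp u f'); auto. }
assert (E := is_RInt_derive_interior (fun x => f (u x) * v x)
  (fun x => f' (u x) * v x * v x + f (u x) * w x) 0 1 Rle_0_1).
cbv beta in E; rewrite u_0, u_1, Hf0 in E.
apply Rminus_diag_uniq_sym.
rewrite <- RInt_Rminus by exr.
replace (0 * v 1 - 0 * v 0) with 0 in E by ring.
refine (eq_trans _ (E _ _ _)).
- apply RInt_ext; intros; simpl; ring.
- intros x Hx; apply (is_derive_Rmult (fun y => f (u y)) v); [apply is_derive_Rcomp|]; auto.
- intros; cont1; auto.
- intros; cont1; auto.
Qed.

(** [v] need not vanish at the endpoints, so [poincare] does not apply to it. Instead
    [int v^2 = - int u w], Young's inequality with weight [k^2] bounds this by [u^2] and [w^2], and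
    [poincare] for [u] absorbs the first of these. *)
Lemma poincare_derivative :
  k * k * RInt (fun x => v x * v x) 0 1 <= RInt (fun x => w x * w x) 0 1.
Proof.
assert (E := RInt_by_parts_slice (fun z => z) (fun _ => 1)
  (fun z => is_derive_id z) (fun z => continuous_const 1 z) eq_refl).
assert (H := poincare).
assert (Hle : 2 * RInt (fun x => - (w x * u x)) 0 1
  <= k * k * RInt (fun x => u x * u x) 0 1 + / (k * k) * RInt (fun x => w x * w x) 0 1).
{ rewrite <- !RInt_Rscal, <- RInt_Rplus by exr.
  apply RInt_le; [lra|exr|exr|]; intros x Hx.
  pose proof (Rle_0_sqr (k * u x + / k * w x)) as Hsq; unfold Rsqr in Hsq.
  assert (E2 : (k * u x + / k * w x) * (k * u x + / k * w x)
    = k * k * (u x * u x) + / (k * k) * (w x * w x) + 2 * (w x * u x)) by (field; lra).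
  lra. }
rewrite E in Hle.
assert (E' : RInt (fun x => 1 * (v x * v x)) 0 1 = RInt (fun x => v x * v x) 0 1).
{ apply RInt_ext; intros; simpl; ring. }
rewrite E' in Hle.
assert (Alg : forall A B C : R, k * k * C <= A -> 2 * A <= k * k * C + / (k * k) * B ->
  k * k * A <= B).
{ intros A B C H1 H2.
  apply Rmult_le_reg_l with (/ (k * k)); [apply Rinv_0_lt_compat; nra|].
  replace (/ (k * k) * (k * k * A)) with A by (field; lra); lra. }
exact (Alg _ _ _ H Hle).
Qed.

(** One-dimensional Sobolev bound, from [u(x)^2 = int_0^x 2 u v]. It lets [d] control the range of
    [u], hence the values of [F'] that matter. *)
Lemma sqr_le_RInt (x : R) : 0 <= x <= 1 ->
  u x * u x <= RInt (fun y => u y * u y + v y * v y) 0 1.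
Proof.
intros Hx.
assert (E := is_RInt_derive_interior (fun y => u y * u y)
  (fun y => v y * u y + u y * v y) 0 x (proj1 Hx)).
cbv beta in E; rewrite u_0, Rmult_0_l, Rminus_0_r in E.
assert (c : forall y, continuous (fun y => u y * u y + v y * v y) y) by (intros; cont1; auto).
rewrite <- E.
- apply Rle_trans with (RInt (fun y => u y * u y + v y * v y) 0 x).
  + apply RInt_le; [lra|..].
    1, 2: apply ex_RInt_cont; [lra|]; intros; cont1; auto.
    intros y _; pose proof (Rle_0_sqr (u y - v y)) as Hsq; unfold Rsqr in Hsq; nra.
  + rewrite <- (RInt_Chasles (fun y => u y * u y + v y * v y) 0 x 1)
      by (apply ex_RInt_cont; auto; lra).
    unfold plus; simpl.
    assert (0 <= RInt (fun y => u y * u y + v y * v y) x 1); [|lra].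
    apply RInt_ge_0; [lra|apply ex_RInt_cont; auto; lra|intros; nra].
- intros y Hy; apply (is_derive_Rmult u u); apply u_der; lra.
- intros; cont1; auto.
- intros; cont1; auto.
Qed.

End Slice.

(** * The energy inequality *)

(* [U, P, X, W, Wx, Wxx, Wt] stand for [u, u_x, u_xx, u_t, u_xt, u_xxt, u_tt]; the first four
   are extended to the whole plane by freezing [x] outside [0,1] and [t] below [t0]. *)
Record strong_flow (eps : R) (F : R -> R) (al : R -> R -> R) (t0 : R)
    (U P X W Wx Wxx Wt : R -> R -> R) : Prop := {
  sf_cont : forall x t, continuity_2d_pt U x t /\ continuity_2d_pt P x t /\
    continuity_2d_pt X x t /\ continuity_2d_pt W x t;
  sf_bdry : forall t, U 0 t = 0 /\ U 1 t = 0 /\ W 0 t = 0 /\ W 1 t = 0;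
  sf_dx : forall x t, 0 < x < 1 -> t0 <= t ->
    is_derive (fun y => U y t) x (P x t) /\ is_derive (fun y => P y t) x (X x t);
  sf_dt : forall x t, 0 < x < 1 -> t0 < t ->
    is_derive (U x) t (W x t) /\ is_derive (P x) t (Wx x t) /\
    is_derive (X x) t (Wxx x t) /\ is_derive (W x) t (Wt x t);
  sf_dxW : forall x t, 0 < x < 1 -> t0 < t ->
    is_derive (fun y => W y t) x (Wx x t) /\ is_derive (fun y => Wx y t) x (Wxx x t);
  sf_cont_int : forall x t, 0 < x < 1 -> t0 < t -> continuity_2d_pt Wx x t /\
    continuity_2d_pt Wxx x t /\ continuity_2d_pt Wt x t;
  sf_eq : forall x t, 0 < x < 1 -> t0 < t ->
    - eps * Wxx x t + Wt x t - X x t = F (U x t) - al x t * W x t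
}.

Lemma locally_2d_box (t0 x t : R) (Q : R -> R -> Prop) :
  0 < x < 1 -> t0 < t -> (forall y s, 0 < y < 1 -> t0 < s -> Q y s) -> locally_2d Q x t.
Proof.
intros Hx Ht HQ.
assert (Hd : 0 < Rmin (Rmin x (1 - x)) (t - t0)) by (repeat apply Rmin_glb_lt; lra).
exists (mkposreal _ Hd); simpl; intros y s Hy Hs.
pose proof (Rmin_l (Rmin x (1 - x)) (t - t0)); pose proof (Rmin_r (Rmin x (1 - x)) (t - t0)).
pose proof (Rmin_l x (1 - x)); pose proof (Rmin_r x (1 - x)).
apply Rabs_lt_between in Hy, Hs; apply HQ; lra.
Qed.

Lemma is_derive_RInt_time (f f' : R -> R -> R) (t0 s t x : R) :
  t0 < s -> s <= t -> 0 < x < 1 ->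
  (forall y r, 0 < y < 1 -> t0 < r -> continuous (f y) r) ->
  (forall y r, 0 < y < 1 -> t0 < r -> is_derive (fun z => f z r) y (f' y r)) ->
  (forall y r, 0 < y < 1 -> t0 < r -> continuity_2d_pt f' y r) ->
  is_derive (fun y => RInt (f y) s t) x (RInt (f' x) s t).
Proof.
intros Hs Hst Hx Hc Hd Hc'.
apply (is_derive_RInt_param_box (fun r y => f y r) (fun r y => f' y r) s t 0 1);
  [exact Hst|exact Hx|..].
- intros r y Hr Hy; apply (Hc y r); lra.
- intros r y Hr Hy; apply Hd; lra.
- intros r Hr; apply continuity_2d_pt_swap, Hc'; lra.
- intros r Hr.
  destruct (locally_2d_box t0 x r (fun y q => is_derive (fun z => f z q) y (f' y q)))
    as [d Hdd]; [exact Hx|lra|exact Hd|].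
  exists d; intros u v Hu Hv; apply Hdd; assumption.
Qed.

Section Energy.

Variables (eps k t0 : R) (F p : R -> R) (al U P X W Wx Wxx Wt : R -> R -> R).
Hypothesis (flow : strong_flow eps F al t0 U P X W Wx Wxx Wt).
Hypothesis (eps_pos : 0 < eps).
Hypothesis (F_cont : forall z, continuous F z).
Hypothesis (p_der : forall x, 0 <= x <= 1 -> is_derive p x (- (k * k + p x * p x))).
Variables (g kap : R).
Hypothesis (g_pos : 0 < g).

Definition lyapunov_density (x t : R) : R :=
  / 2 * ((eps * X x t - W x t) * (eps * X x t - W x t)) + g / 2 * (W x t * W x t)
  + (1 + g) * (/ 2 * (P x t * P x t) - RInt F 0 (U x t)).

(** What remains of the density of [V'] up to fluxes: the part [eps kap u_xx^2] of the damping and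
    the terms in [a] have been traded for [- w^2]. *)
Definition dissipation_density (x t : R) : R :=
  - eps * (1 - kap) * (X x t * X x t) - eps * (X x t * F (U x t)) - W x t * W x t.

Lemma continuity_lyapunov_density (x t : R) : continuity_2d_pt lyapunov_density x t.
Proof.
destruct (sf_cont _ _ _ _ _ _ _ _ _ _ _ flow x t) as (HU & HP & HX & HW).
unfold lyapunov_density.
assert (HF : continuity_2d_pt (fun y s => RInt F 0 (U y s)) x t).
{ apply (continuity_2d_pt_comp1 (RInt F 0)); [|exact HU].
  eapply is_derive_continuous, is_derive_RInt_upper, F_cont. }
cont2; assumption.
Qed.

Lemma continuity_dissipation_density (x t : R) : continuity_2d_pt dissipation_density x t.
Proof.
destruct (sf_cont _ _ _ _ _ _ _ _ _ _ _ flow x t) as (HU & HP & HX & HW).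
unfold dissipation_density.
assert (HF : continuity_2d_pt (fun y s => F (U y s)) x t)
  by (apply (continuity_2d_pt_comp1 F); auto).
cont2; assumption.
Qed.

Lemma is_derive_lyapunov_density (x t : R) : 0 < x < 1 -> t0 < t ->
  is_derive (lyapunov_density x) t
    ((eps * X x t - W x t) * (eps * Wxx x t - Wt x t) + g * (W x t * Wt x t)
     + (1 + g) * (P x t * Wx x t - F (U x t) * W x t)).
Proof.
intros Hx Ht.
destruct (sf_dt _ _ _ _ _ _ _ _ _ _ _ flow x t Hx Ht) as (HU & HP & HX & HW).
assert (HF : is_derive (fun s => RInt F 0 (U x s)) t (F (U x t) * W x t)).
{ apply (is_derive_Rcomp (RInt F 0)); [apply is_derive_RInt_upper, F_cont|exact HU]. }
assert (HZ : is_derive (fun s => eps * X x s - W x s) t (eps * Wxx x t - Wt x t)).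
{ apply is_derive_Rminus; [apply is_derive_Rscal|]; assumption. }
unfold lyapunov_density.
evar_last.
- apply is_derive_Rplus; [apply is_derive_Rplus|].
  + apply is_derive_Rscal.
    apply (is_derive_Rmult (fun s => eps * X x s - W x s) (fun s => eps * X x s - W x s));
      exact HZ.
  + apply is_derive_Rscal, (is_derive_Rmult (W x) (W x)); exact HW.
  + apply is_derive_Rscal, is_derive_Rminus; [|exact HF].
    apply is_derive_Rscal, (is_derive_Rmult (P x) (P x)); exact HP.
- simpl; field.
Qed.

(** The assumption is the pointwise absorption of [eps a u_xx w]: the term [g eps k^2 w^2] in it is
    the gain from integrating [g eps w w_xx] in [x], that is, Poincare's inequality for [w]. *)
Lemma energy_inequality (s t : R) :
  t0 < s -> s <= t ->
  (forall x r y z, 0 < x < 1 -> s <= r <= t ->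
    eps * al x r * y * z - (al x r + g * (al x r + eps * (k * k))) * (z * z)
    <= eps * kap * (y * y) - z * z) ->
  RInt (fun x => lyapunov_density x t) 0 1 - RInt (fun x => lyapunov_density x s) 0 1
  <= RInt (fun r => RInt (fun x => dissipation_density x r) 0 1) s t.
Proof.
intros Hs Hst Hal.
assert (Hc := sf_cont _ _ _ _ _ _ _ _ _ _ _ flow).
assert (HcU := fun x r => proj1 (Hc x r)).
assert (HcP := fun x r => proj1 (proj2 (Hc x r))).
assert (HcX := fun x r => proj1 (proj2 (proj2 (Hc x r)))).
assert (HcW := fun x r => proj2 (proj2 (proj2 (Hc x r)))).
assert (Hci := sf_cont_int _ _ _ _ _ _ _ _ _ _ _ flow).
assert (Hb := sf_bdry _ _ _ _ _ _ _ _ _ _ _ flow).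
rewrite <- fubini_rectangle; [|lra|exact Hst|apply continuity_dissipation_density].
apply Rminus_le.
assert (Hcl : forall r x, continuous (fun x => lyapunov_density x r) x)
  by (intros; apply (continuity_2d_pt_fst lyapunov_density), continuity_lyapunov_density).
assert (Hcd : forall x, continuous (fun x => RInt (dissipation_density x) s t) x).
{ intros x; apply (continuous_RInt_param (fun r y => dissipation_density y r)); [exact Hst|].
  apply filter_forall; intros y r _; apply continuity_2d_pt_swap, continuity_dissipation_density. }
assert (Hr : forall x, continuous (fun x => lyapunov_density x t - lyapunov_density x s
  - RInt (dissipation_density x) s t) x) by (intros x; cont1; auto).
rewrite <- 2!RInt_Rminus by exr.
pose (I1 := fun x => RInt (fun r => W x r * W x r) s t).
pose (I2 := fun x => RInt (fun r => W x r * Wx x r) s t).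
pose (I3 := fun x => RInt (fun r => Wx x r * Wx x r + W x r * Wxx x r) s t).
pose (I4 := fun x => RInt (fun r => P x r * W x r) s t).
pose (I5 := fun x => RInt (fun r => X x r * W x r + P x r * Wx x r) s t).
assert (HI1 : forall x, 0 < x < 1 -> is_derive I1 x (2 * I2 x)).
{ intros x Hx; unfold I2; rewrite <- RInt_Rscal.
  - apply (is_derive_RInt_time (fun x r => W x r * W x r) (fun x r => 2 * (W x r * Wx x r)) t0);
      auto; intros y r Hy Hr'.
    + cont1; apply (continuity_2d_pt_snd W), HcW.
    + destruct (sf_dxW _ _ _ _ _ _ _ _ _ _ _ flow y r Hy Hr') as [D _].
      evar_last; [apply (is_derive_Rmult (fun z => W z r) (fun z => W z r)); exact D|simpl; ring].
    + destruct (Hci y r Hy Hr') as (? & ? & ?); cont2; auto.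
  - apply ex_RInt_cont; [exact Hst|]; intros r Hr'; cont1.
    + apply (continuity_2d_pt_snd W), HcW.
    + apply (continuity_2d_pt_snd Wx), Hci; [exact Hx|lra]. }
assert (HI2 : forall x, 0 < x < 1 -> is_derive I2 x (I3 x)).
{ intros x Hx.
  apply (is_derive_RInt_time (fun x r => W x r * Wx x r)
    (fun x r => Wx x r * Wx x r + W x r * Wxx x r) t0); auto; intros y r Hy Hr';
    destruct (Hci y r Hy Hr') as (? & ? & ?).
  - cont1; [apply (continuity_2d_pt_snd W), HcW|now apply (continuity_2d_pt_snd Wx)].
  - destruct (sf_dxW _ _ _ _ _ _ _ _ _ _ _ flow y r Hy Hr') as [D1 D2].
    apply (is_derive_Rmult (fun z => W z r) (fun z => Wx z r)); assumption.
  - cont2; auto. }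
assert (HI4 : forall x, 0 < x < 1 -> is_derive I4 x (I5 x)).
{ intros x Hx.
  apply (is_derive_RInt_time (fun x r => P x r * W x r)
    (fun x r => X x r * W x r + P x r * Wx x r) t0); auto; intros y r Hy Hr';
    destruct (Hci y r Hy Hr') as (? & ? & ?).
  - cont1; [apply (continuity_2d_pt_snd P), HcP|apply (continuity_2d_pt_snd W), HcW].
  - destruct (sf_dxW _ _ _ _ _ _ _ _ _ _ _ flow y r Hy Hr') as [D1 D2].
    destruct (sf_dx _ _ _ _ _ _ _ _ _ _ _ flow y r Hy ltac:(lra)) as [D3 D4].
    apply (is_derive_Rmult (fun z => P z r) (fun z => W z r)); assumption.
  - cont2; auto. }
assert (HI1c : forall x, continuous I1 x).
{ intros x; apply (continuous_RInt_param (fun r y => W y r * W y r)); [exact Hst|].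
  apply filter_forall; intros y r _.
  apply (continuity_2d_pt_swap (fun y r => W y r * W y r)); cont2; auto. }
assert (HI4c : forall x, continuous I4 x).
{ intros x; apply (continuous_RInt_param (fun r y => P y r * W y r)); [exact Hst|].
  apply filter_forall; intros y r _.
  apply (continuity_2d_pt_swap (fun y r => P y r * W y r)); cont2; auto. }
assert (Hzero : forall f : R -> R, (forall r, f r = 0) -> RInt f s t = 0).
{ intros f Hf; rewrite (RInt_ext f (fun _ => 0)) by (intros; apply Hf).
  rewrite RInt_const; unfold scal; simpl; unfold mult; simpl; ring. }
assert (HI10 : I1 0 = 0) by (apply Hzero; intros r; rewrite (proj1 (proj2 (proj2 (Hb r)))); ring).
assert (HI11 : I1 1 = 0) by (apply Hzero; intros r; rewrite (proj2 (proj2 (proj2 (Hb r)))); ring).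
assert (HI40 : I4 0 = 0) by (apply Hzero; intros r; rewrite (proj1 (proj2 (proj2 (Hb r)))); ring).
assert (HI41 : I4 1 = 0) by (apply Hzero; intros r; rewrite (proj2 (proj2 (proj2 (Hb r)))); ring).
assert (Hge : 0 < g * eps) by (apply Rmult_lt_0_compat; assumption).
(* The whole flux is [G' + N]. Here [G'] is the time integral of [g eps w w_x], uncontrolled at the
   boundary, while [N] gathers [- g eps p w^2 + (1 + g) u_x w], which is continuous up to the
   boundary and vanishes there because [w] does. *)
apply (RInt_le_0_of_flux
  (fun x => g * eps / 2 * I1 x) (fun x => g * eps * I2 x)
  (fun x => - (g * eps) * (p x * I1 x) + (1 + g) * I4 x)
  (fun x => g * eps * I3 x + (- (g * eps) * (- (k * k + p x * p x) * I1 x + p x * (2 * I2 x))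
     + (1 + g) * I5 x))); cbv beta.
- intros x; cont1; auto.
- intros x; apply Rmult_le_pos; [lra|]; apply RInt_ge_0; [exact Hst| |].
  + apply ex_RInt_cont; [exact Hst|]; intros; cont1; apply (continuity_2d_pt_snd W), HcW.
  + intros r _; apply Rle_0_sqr.
- rewrite HI10; ring.
- rewrite HI11; ring.
- intros x Hx; evar_last; [apply is_derive_Rscal; apply HI1, Hx|simpl; field].
- intros x Hx; cont1; auto.
  eapply is_derive_continuous, p_der, Hx.
- rewrite HI10, HI40; ring.
- rewrite HI11, HI41; ring.
- intros x Hx; apply is_derive_Rplus; [apply is_derive_Rscal, HI2, Hx|].
  apply is_derive_Rplus; [|apply is_derive_Rscal, HI4, Hx].
  apply is_derive_Rscal, (is_derive_Rmult p I1); [apply p_der; lra|apply HI1, Hx].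
- exact Hr.
- intros x Hx.
  assert (Hcx : forall r, s <= r <= t -> continuous (X x) r /\ continuous (W x) r /\
    continuous (P x) r /\ continuous (Wx x) r /\ continuous (Wxx x) r /\ continuous (Wt x) r /\
    continuous (fun r => F (U x r)) r).
  { intros r Hr'; destruct (Hci x r Hx ltac:(lra)) as (? & ? & ?).
    refine (conj _ (conj _ (conj _ (conj _ (conj _ (conj _ _))))));
      try (simple apply continuity_2d_pt_snd; auto).
    apply (continuity_2d_pt_snd (fun x r => F (U x r))), (continuity_2d_pt_comp1 F); auto. }
  pose (J := fun r => (eps * X x r - W x r) * (eps * Wxx x r - Wt x r) + g * (W x r * Wt x r)
     + (1 + g) * (P x r * Wx x r - F (U x r) * W x r)).
  assert (HJ : RInt J s t = lyapunov_density x t - lyapunov_density x s).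
  { apply is_RInt_derive_interior; [exact Hst| | |].
    - intros r Hr'; apply is_derive_lyapunov_density; [exact Hx|lra].
    - intros r _; apply continuity_2d_pt_snd, continuity_lyapunov_density.
    - intros r Hr'; destruct (Hcx r Hr') as (? & ? & ? & ? & ? & ? & ?); unfold J; cont1; auto. }
  rewrite <- HJ.
  assert (Hd : forall r, s <= r <= t -> continuous (dissipation_density x) r)
    by (intros; apply continuity_2d_pt_snd, continuity_dissipation_density).
  unfold I1, I2, I3, I5.
  replace (g * eps * RInt (fun r => Wx x r * Wx x r + W x r * Wxx x r) s t + (- (g * eps) *
     (- (k * k + p x * p x) * RInt (fun r => W x r * W x r) s t
      + p x * (2 * RInt (fun r => W x r * Wx x r) s t))
     + (1 + g) * RInt (fun r => X x r * W x r + P x r * Wx x r) s t))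
  with (g * eps * RInt (fun r => Wx x r * Wx x r + W x r * Wxx x r) s t
     + g * eps * (k * k + p x * p x) * RInt (fun r => W x r * W x r) s t
     + - (2 * g * eps * p x) * RInt (fun r => W x r * Wx x r) s t
     + (1 + g) * RInt (fun r => X x r * W x r + P x r * Wx x r) s t) by ring.
  rewrite <- !RInt_Rscal.
  2-5: apply ex_RInt_cont; [exact Hst|]; intros r Hr';
    destruct (Hcx r Hr') as (? & ? & ? & ? & ? & ? & ?); cont1; assumption.
  rewrite <- RInt_Rminus.
  2-3: apply ex_RInt_cont; [exact Hst|]; intros r Hr';
    destruct (Hcx r Hr') as (? & ? & ? & ? & ? & ? & ?); unfold J; cont1; auto.
  rewrite <- 3!RInt_Rplus.
  2-7: apply ex_RInt_cont; [exact Hst|]; intros r Hr';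
    destruct (Hcx r Hr') as (? & ? & ? & ? & ? & ? & ?); unfold J; cont1; auto.
  apply RInt_le; [exact Hst|..].
  1-2: apply ex_RInt_cont; [exact Hst|]; intros r Hr';
    destruct (Hcx r Hr') as (? & ? & ? & ? & ? & ? & ?); unfold J; cont1; auto.
  intros r Hr'; unfold J, dissipation_density.
  assert (E := sf_eq _ _ _ _ _ _ _ _ _ _ _ flow x r Hx ltac:(lra)).
  assert (Q := Hal x r (X x r) (W x r) Hx ltac:(lra)).
  replace (Wt x r) with (eps * Wxx x r + X x r + F (U x r) - al x r * W x r) by lra.
  (* Once [u_tt] is eliminated by the equation, the two sides differ by the slack in [Q] plus
     [g eps (w_x - p w)^2]. *)
  assert (Hsq := Rmult_le_pos _ _ (Rlt_le _ _ Hge) (Rle_0_sqr (Wx x r - p x * W x r))).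
  unfold Rsqr in Hsq; nra.
Qed.

End Energy.

(** * Regularity of classical solutions *)

(** Turns an identity between increments, which survives limits and differentiation in time, back
    into a derivative. The base point is chosen inside the interval because [f] and [g] are not
    controlled at [l]. *)
Lemma is_derive_of_increments (f g : R -> R) (l r x : R) :
  l < x < r -> (forall y, l < y < r -> continuous g y) ->
  (forall a y, l < a -> a <= y -> y < r -> f y - f a = RInt g a y) ->
  is_derive f x (g x).
Proof.
intros Hx Hg Hf.
pose (a := (l + x) / 2).
apply is_derive_ext_loc with (fun y => f a + RInt g a y).
- apply (locally_open_interval a r); [unfold a; lra|]; intros y Hy.
  rewrite <- (Hf a y); unfold a in *; lra.
- replace (g x) with (0 + g x) by ring.
  apply is_derive_Rplus; [apply (is_derive_const (V := R_NormedModule))|].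
  apply (is_derive_RInt (V := R_NormedModule) g (RInt g a) a); [|now apply Hg].
  apply (locally_open_interval a r); [unfold a; lra|]; intros y Hy.
  apply (RInt_correct (V := R_CompleteNormedModule)), ex_RInt_cont; [lra|].
  intros z Hz; apply Hg; unfold a in *; lra.
Qed.

(** The increment formula in [x] passes to the limit [t -> t0] by joint continuity. This gives
    meaning to [u_x] and [u_xx] at the initial time, where the equation says nothing. *)
Lemma is_derive_initial_slice (f g : R -> R -> R) (t0 x : R) :
  (forall y t, continuity_2d_pt f y t) -> (forall y t, continuity_2d_pt g y t) ->
  (forall y t, 0 < y < 1 -> t0 < t -> is_derive (fun z => f z t) y (g y t)) ->
  0 < x < 1 -> is_derive (fun y => f y t0) x (g x t0).
Proof.
intros Hf Hg Hd Hx.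
apply (is_derive_of_increments (fun y => f y t0) (fun y => g y t0) 0 1); [exact Hx|..].
- intros y _; apply (continuity_2d_pt_fst g), Hg.
- intros a y Ha Hay Hy; apply Rminus_diag_uniq.
  apply (continuous_eq_closure (fun t => f y t - f a t - RInt (fun z => g z t) a y) t0 (t0 + 1));
    [lra|lra| |].
  + cont1; try apply continuity_2d_pt_snd; auto.
    apply continuous_RInt_param; [exact Hay|apply filter_forall; intros; apply Hg].
  + intros t Ht.
    rewrite (is_RInt_derive_interior (fun z => f z t) (fun z => g z t) a y); [ring|exact Hay|..].
    * intros z Hz; apply Hd; lra.
    * intros z _; apply (continuity_2d_pt_fst f), Hf.
    * intros z _; apply (continuity_2d_pt_fst g), Hg.
Qed.

(** The increment is split at [(x, s)]: the part in time is small by continuity at fixed [x], the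
    part in space by the mean value theorem, since [g] is bounded near [(x, t)]. *)
Lemma continuity_2d_pt_of_partial (f g : R -> R -> R) (t0 x t : R) :
  0 < x < 1 -> t0 < t -> continuous (f x) t -> continuity_2d_pt g x t ->
  (forall y s, 0 < y < 1 -> t0 < s -> is_derive (fun z => f z s) y (g y s)) ->
  continuity_2d_pt f x t.
Proof.
intros Hx Ht Hf Hg Hd e.
pose proof (cond_pos e) as epos.
destruct (continuous_small_near (f x) t (e / 2) ltac:(lra) Hf) as (d1 & Hd1 & Hd1').
destruct (Hg (mkposreal 1 Rlt_0_1)) as [d2 Hd2]; simpl in Hd2.
pose (M := Rabs (g x t) + 1).
assert (HM : 0 < M) by (unfold M; pose proof (Rabs_pos (g x t)); lra).
pose (d3 := e / (2 * M)).
assert (Hd3 : 0 < d3) by (apply Rdiv_lt_0_compat; lra).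
destruct (locally_2d_box t0 x t (fun y s => 0 < y < 1 /\ t0 < s)) as [d4 Hd4]; auto.
assert (Hpos : 0 < Rmin (Rmin d1 d2) (Rmin d3 d4))
  by (repeat apply Rmin_glb_lt; try apply cond_pos; lra).
exists (mkposreal _ Hpos); simpl; intros y s Hy Hs.
pose proof (Rmin_l (Rmin d1 d2) (Rmin d3 d4)); pose proof (Rmin_r (Rmin d1 d2) (Rmin d3 d4)).
pose proof (Rmin_l d1 d2); pose proof (Rmin_r d1 d2);
pose proof (Rmin_l d3 d4); pose proof (Rmin_r d3 d4).
destruct (Hd4 y s) as [Hy1 Hs1]; [lra|lra|].
destruct (MVT_gen (fun z => f z s) x y (fun z => g z s)) as (c & Hc & E).
- intros z Hz; apply Hd; [|exact Hs1]; unfold Rmin, Rmax in Hz; destruct Rle_dec; lra.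
- intros z Hz; apply continuity_pt_filterlim.
  apply (is_derive_continuous (fun z => f z s) z (g z s)), Hd; [|exact Hs1].
  unfold Rmin, Rmax in Hz; destruct Rle_dec; lra.
- assert (Hcx : Rabs (c - x) <= Rabs (y - x)).
  { unfold Rmin, Rmax in Hc; destruct Rle_dec; unfold Rabs; repeat destruct Rcase_abs; lra. }
  assert (HgM : Rabs (g c s) <= M).
  { assert (H5 : Rabs (g c s - g x t) < 1) by (apply Hd2; lra).
    unfold M; pose proof (Rabs_triang (g c s - g x t) (g x t)) as H6.
    replace (g c s - g x t + g x t) with (g c s) in H6 by ring; lra. }
  assert (H5 : Rabs (f x s - f x t) < e / 2) by (apply Hd1'; lra).
  assert (H6 : Rabs (f y s - f x s) <= e / 2).
  { rewrite E, Rabs_mult.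
    apply Rle_trans with (M * d3); [|right; unfold d3; field; lra].
    apply Rmult_le_compat; try apply Rabs_pos; lra. }
  replace (f y s - f x t) with ((f y s - f x s) + (f x s - f x t)) by ring.
  pose proof (Rabs_triang (f y s - f x s) (f x s - f x t)); lra.
Qed.

(* The mixed derivative is obtained from the second-order Taylor formula in [x], whose
   other terms are differentiable in time. *)
Lemma mixed_derivative (U P X W Y : R -> R -> R) (t0 : R) :
  (forall x t, 0 < x < 1 -> t0 < t ->
    is_derive (fun y => U y t) x (P x t) /\ is_derive (fun y => P y t) x (X x t) /\
    is_derive (U x) t (W x t) /\ is_derive (X x) t (Y x t)) ->
  (forall x t, 0 < x < 1 -> t0 < t ->
    continuity_2d_pt P x t /\ continuity_2d_pt X x t /\
    continuity_2d_pt W x t /\ continuity_2d_pt Y x t) ->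
  exists Z : R -> R -> R, forall x t, 0 < x < 1 -> t0 < t ->
    is_derive (P x) t (Z x t) /\ is_derive (fun y => W y t) x (Z x t) /\
    is_derive (fun y => Z y t) x (Y x t) /\ continuity_2d_pt Z x t.
Proof.
intros Hd Hc.
(* [e x] is just an interior point to the right of [x]. [Z] is the formal time derivative of [P]
   solved from [U(e) = U(x) + (e - x) P(x) + int_x^e (e - y) X(y) dy]. *)
pose (e := fun x => (1 + x) / 2).
pose (Z := fun x t =>
  / (e x - x) * (W (e x) t - W x t - RInt (fun y => (e x - y) * Y y t) x (e x))).
assert (cont_slice : forall f : R -> R -> R,
  (forall x t, 0 < x < 1 -> t0 < t -> continuity_2d_pt f x t) ->
  forall x t, 0 < x < 1 -> t0 < t -> continuous (fun y => f y t) x /\ continuous (f x) t).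
{ intros f Hf x t Hx Ht; split; [apply (continuity_2d_pt_fst f)|apply (continuity_2d_pt_snd f)];
  now apply Hf. }
assert (cP := cont_slice P (fun x t Hx Ht => proj1 (Hc x t Hx Ht))).
assert (cX := cont_slice X (fun x t Hx Ht => proj1 (proj2 (Hc x t Hx Ht)))).
assert (cW := cont_slice W (fun x t Hx Ht => proj1 (proj2 (proj2 (Hc x t Hx Ht))))).
assert (cY := cont_slice Y (fun x t Hx Ht => proj2 (proj2 (proj2 (Hc x t Hx Ht))))).
assert (under : forall f f' : R -> R -> R,
  (forall x t, 0 < x < 1 -> t0 < t -> continuous (fun y => f y t) x) ->
  (forall x t, 0 < x < 1 -> t0 < t -> is_derive (f x) t (f' x t)) ->
  (forall x t, 0 < x < 1 -> t0 < t -> continuity_2d_pt f' x t) ->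
  forall a b t, 0 < a -> a <= b -> b < 1 -> t0 < t ->
  is_derive (fun s => RInt (fun y => f y s) a b) t (RInt (fun y => f' y t) a b)).
{ intros f f' H1 H2 H3 a b t Ha Hab Hb Ht.
  apply (is_derive_RInt_param_box f f' a b t0 (t + 1)); [exact Hab|lra|..].
  - intros; apply H1; lra.
  - intros; apply H2; lra.
  - intros; apply H3; lra.
  - intros x Hx; apply (locally_2d_box t0); auto; lra. }
assert (HPZ : forall x t, 0 < x < 1 -> t0 < t -> is_derive (P x) t (Z x t)).
{ intros x t Hx Ht.
  assert (He : x < e x < 1) by (unfold e; lra).
  apply is_derive_ext_loc with
    (fun s => / (e x - x) * (U (e x) s - U x s - RInt (fun y => (e x - y) * X y s) x (e x))).
  - apply (locally_gt t0); [exact Ht|]; intros s Hs.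
    assert (E := is_RInt_derive_interior (fun y => (e x - y) * P y s + U y s)
      (fun y => (e x - y) * X y s) x (e x) (Rlt_le _ _ (proj1 He))).
    cbv beta in E; rewrite E.
    + simpl; field; lra.
    + intros y Hy; destruct (Hd y s) as (D1 & D2 & _); [lra|exact Hs|].
      evar_last.
      * apply is_derive_Rplus; [|exact D1].
        apply (is_derive_Rmult (fun y => e x - y) (fun y => P y s)); [|exact D2].
        apply is_derive_Rminus; [apply (is_derive_const (V := R_NormedModule))|apply is_derive_id].
      * unfold zero, one; simpl; unfold one; simpl; ring.
    + intros y Hy; cont1; [apply continuous_id|apply cP; lra|].
      apply (is_derive_continuous (fun y => U y s) y (P y s)), Hd; lra.
    + intros y Hy; cont1; [apply continuous_id|apply cX; lra].
  - unfold Z; apply is_derive_Rscal; repeat apply is_derive_Rminus; try (apply Hd; lra).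
    apply (under (fun y s => (e x - y) * X y s) (fun y s => (e x - y) * Y y s)); try lra.
    + intros y s Hy Hs; cont1; [apply continuous_id|now apply cX].
    + intros y s Hy Hs; apply is_derive_Rscal; now apply Hd.
    + intros y s Hy Hs; cont2; [apply continuity_2d_pt_id1|now apply Hc]. }
assert (HZc : forall x t, 0 < x < 1 -> t0 < t -> continuous (Z x) t).
{ intros x t Hx Ht.
  assert (He : x < e x < 1) by (unfold e; lra).
  unfold Z; cont1; [apply cW; lra|apply cW; lra|].
  apply (continuous_RInt_param (fun y s => (e x - y) * Y y s)); [lra|].
  apply (locally_gt t0); [exact Ht|]; intros s Hs y Hy.
  cont2; [apply continuity_2d_pt_id1|apply Hc; lra]. }
(* The time derivative of [int_a^y X = P(y) - P(a)] is computed in two ways. *)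
assert (HZinc : forall t, t0 < t -> forall a y, 0 < a -> a <= y -> y < 1 ->
  Z y t - Z a t = RInt (fun z => Y z t) a y).
{ intros t Ht a y Ha Hay Hy.
  assert (D1 : is_derive (fun s => RInt (fun z => X z s) a y) t (RInt (fun z => Y z t) a y)).
  { apply under; auto; [intros; now apply cX|intros; now apply Hd|intros; now apply Hc]. }
  assert (D2 : is_derive (fun s => RInt (fun z => X z s) a y) t (Z y t - Z a t)).
  { apply is_derive_ext_loc with (fun s => P y s - P a s).
    - apply (locally_gt t0); [exact Ht|]; intros s Hs; symmetry.
      apply (is_RInt_derive_interior (fun z => P z s)); [exact Hay|..];
        intros z Hz; [apply Hd|apply cP|apply cX]; lra.
    - apply is_derive_Rminus; apply HPZ; lra. }
  now rewrite <- (is_derive_unique _ _ _ D1), <- (is_derive_unique _ _ _ D2). }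
assert (HZx : forall x t, 0 < x < 1 -> t0 < t -> is_derive (fun y => Z y t) x (Y x t)).
{ intros x t Hx Ht.
  apply (is_derive_of_increments (fun y => Z y t) (fun y => Y y t) 0 1); auto.
  intros y Hy; now apply cY. }
(* Joint continuity of [Z] is what allows [int P] to be differentiated in time under the integral
   sign, which then identifies [Z] as the derivative of [W] in [x]. *)
assert (HZ2 : forall x t, 0 < x < 1 -> t0 < t -> continuity_2d_pt Z x t).
{ intros x t Hx Ht; apply (continuity_2d_pt_of_partial Z Y t0); auto; now apply Hc. }
exists Z; intros x t Hx Ht.
refine (conj (HPZ x t Hx Ht) (conj _ (conj (HZx x t Hx Ht) (HZ2 x t Hx Ht)))).
apply (is_derive_of_increments (fun y => W y t) (fun y => Z y t) 0 1); [exact Hx|..].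
- intros y Hy; now apply (continuity_2d_pt_fst Z), HZ2.
- intros a y Ha Hay Hy.
  assert (D1 : is_derive (fun s => RInt (fun z => P z s) a y) t (RInt (fun z => Z z t) a y)).
  { apply under; auto; intros; now apply cP. }
  assert (D2 : is_derive (fun s => RInt (fun z => P z s) a y) t (W y t - W a t)).
  { apply is_derive_ext_loc with (fun s => U y s - U a s).
    - apply (locally_gt t0); [exact Ht|]; intros s Hs; symmetry.
      apply (is_RInt_derive_interior (fun z => U z s)); [exact Hay|..]; intros z Hz.
      + apply Hd; lra.
      + apply (is_derive_continuous (fun y => U y s) z (P z s)), Hd; lra.
      + apply cP; lra.
    - apply is_derive_Rminus; apply Hd; lra. }
  now rewrite <- (is_derive_unique _ _ _ D1), <- (is_derive_unique _ _ _ D2).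
Qed.

(** The projection of the plane onto the closed half-strip is continuous and takes its values there,
    so a limit restricted to the half-strip becomes an unrestricted one. *)
Lemma continuity_2d_pt_clamp (f : R -> R -> R) (t0 : R) :
  (forall q : R * R, 0 <= fst q <= 1 /\ t0 <= snd q ->
    cont_within (fun q : R * R => 0 <= fst q <= 1 /\ t0 <= snd q)
      (fun q => f (fst q) (snd q)) q) ->
  forall x t, continuity_2d_pt (fun y s => f (clamp 0 1 y) (Rmax t0 s)) x t.
Proof.
intros Hf x t; apply continuity_2d_pt_filterlim.
assert (Hin : forall y s, 0 <= clamp 0 1 y <= 1 /\ t0 <= Rmax t0 s).
{ intros y s; split; [apply clamp_bounds; lra|apply Rmax_l]. }
apply (filterlim_comp _ _ _ (fun z : R * R => (clamp 0 1 (fst z), Rmax t0 (snd z)))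
  (fun z => f (fst z) (snd z)) _
  (within (fun q : R * R => 0 <= fst q <= 1 /\ t0 <= snd q)
    (locally (clamp 0 1 x, Rmax t0 t)))); [|exact (Hf (_, _) (Hin x t))].
intros Q HQ; unfold filtermap, within in *.
assert (Hc : continuous (fun z : R * R => (clamp 0 1 (fst z), Rmax t0 (snd z))) (x, t)).
{ apply (continuous_comp_2 (fun z : R * R => clamp 0 1 (fst z))
    (fun z : R * R => Rmax t0 (snd z)) (fun a b => (a, b))).
  - apply (continuous_comp fst (clamp 0 1)); [apply continuous_fst|apply continuous_clamp].
  - apply (continuous_comp snd (Rmax t0)); [apply continuous_snd|apply continuous_Rmax_const].
  - apply continuous_ext with (fun z => z); [intros [? ?]; reflexivity|apply continuous_id]. }
specialize (Hc _ HQ); unfold filtermap in Hc.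
revert Hc; apply filter_imp; intros z Hz; apply Hz, Hin.
Qed.

Lemma continuity_2d_pt_interior (f : R -> R -> R) (t0 x t : R) :
  0 < x < 1 -> t0 < t ->
  cont_within (fun q : R * R => 0 < fst q < 1 /\ t0 < snd q) (fun q => f (fst q) (snd q)) (x, t) ->
  continuity_2d_pt f x t.
Proof.
intros Hx Ht Hf; apply continuity_2d_pt_filterlim; intros Q HQ.
specialize (Hf Q HQ); unfold filtermap, within in *.
assert (Hb : locally (x, t) (fun z : R * R => 0 < fst z < 1 /\ t0 < snd z)).
{ apply (locally_2d_locally (fun y s => 0 < y < 1 /\ t0 < s)), (locally_2d_box t0); auto. }
generalize (filter_and _ _ Hf Hb); apply filter_imp; intros z [H1 H2]; auto.
Qed.

(** The nonlinear coefficient is evaluated along the solution once and for all; the energy argument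
    then only sees a function [al] of [x] and [t]. *)
Lemma flow_of_solution (eps : R) (F : R -> R) (a : R -> R -> R -> R -> R -> R -> R)
    (t0 : R) (u0 u1 : R -> R) (u ut : R -> R -> R) :
  is_solution eps F a t0 u0 u1 u ut ->
  exists U P X W Wx Wxx Wt : R -> R -> R,
    strong_flow eps F (fun x t => a x t (U x t) (P x t) (X x t) (W x t)) t0
      U P X W Wx Wxx Wt /\
    (forall x t, 0 <= x <= 1 -> t0 <= t -> U x t = u x t /\ W x t = ut x t).
Proof.
intros (ux & uxx & utt & uxxt & Hd & Hc & Hci & Heq & Hb & _).
pose (ext := fun f : R -> R -> R => fun y s => f (clamp 0 1 y) (Rmax t0 s)).
assert (Hext : forall f x t, 0 <= x <= 1 -> t0 <= t -> ext f x t = f x t).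
{ intros f x t Hx Ht; unfold ext; rewrite clamp_id, Rmax_right; auto. }
assert (cU : forall x t, continuity_2d_pt (ext u) x t)
  by (apply continuity_2d_pt_clamp; intros; now apply Hc).
assert (cP : forall x t, continuity_2d_pt (ext ux) x t)
  by (apply continuity_2d_pt_clamp; intros; now apply Hc).
assert (cX : forall x t, continuity_2d_pt (ext uxx) x t)
  by (apply continuity_2d_pt_clamp; intros; now apply Hc).
assert (cW : forall x t, continuity_2d_pt (ext ut) x t)
  by (apply continuity_2d_pt_clamp; intros; now apply Hc).
assert (dx_ext : forall f x t l, 0 < x < 1 -> t0 < t -> is_derive (fun y => f y t) x l ->
  is_derive (fun y => ext f y t) x l).
{ intros f x t l Hx Ht; apply is_derive_ext_loc.
  apply (locally_open_interval 0 1); [exact Hx|]; intros y Hy; symmetry; apply Hext; lra. }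
assert (dt_ext : forall f x t l, 0 < x < 1 -> t0 < t -> is_derive (f x) t l ->
  is_derive (ext f x) t l).
{ intros f x t l Hx Ht; apply is_derive_ext_loc.
  apply (locally_gt t0); [exact Ht|]; intros s Hs; symmetry; apply Hext; lra. }
assert (Hdx : forall x t, 0 < x < 1 -> t0 < t ->
  is_derive (fun y => ext u y t) x (ext ux x t) /\
  is_derive (fun y => ext ux y t) x (ext uxx x t)).
{ intros x t Hx Ht; rewrite 2!(Hext _ x t) by lra.
  split; apply dx_ext; auto; now apply Hd. }
assert (Hdt : forall x t, 0 < x < 1 -> t0 < t ->
  is_derive (ext u x) t (ext ut x t) /\ is_derive (ext uxx x) t (uxxt x t) /\
  is_derive (ext ut x) t (utt x t)).
{ intros x t Hx Ht; rewrite (Hext ut x t) by lra.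
  refine (conj _ (conj _ _)); apply dt_ext; auto; now apply Hd. }
assert (Hci' : forall x t, 0 < x < 1 -> t0 < t ->
  continuity_2d_pt utt x t /\ continuity_2d_pt uxxt x t).
{ intros x t Hx Ht; split; apply (continuity_2d_pt_interior _ t0); auto;
    now apply (Hci (x, t)). }
destruct (mixed_derivative (ext u) (ext ux) (ext uxx) (ext ut) uxxt t0) as [Z HZ].
{ intros x t Hx Ht; destruct (Hdx x t Hx Ht) as [D1 D2].
  destruct (Hdt x t Hx Ht) as (D3 & D4 & _).
  exact (conj D1 (conj D2 (conj D3 D4))). }
{ intros x t Hx Ht; destruct (Hci' x t Hx Ht); auto. }
assert (HbU : forall t, ext u 0 t = 0 /\ ext u 1 t = 0).
{ intros t; unfold ext; rewrite 2!clamp_id by lra; apply Hb, Rmax_l. }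
(* The lateral trace of [u_t]: pass to the boundary in [u(x,t) - u(x,t0) = int u_t]. *)
assert (HbW : forall z, (forall t, ext u z t = 0) -> 0 <= z <= 1 -> forall t, ext ut z t = 0).
{ intros z Hz Hz1.
  assert (HI : forall r, t0 <= r -> RInt (ext ut z) t0 r = 0).
  { intros r Hr.
    apply (continuous_eq_closure (fun y => RInt (ext ut y) t0 r - (ext u y r - ext u y t0)) 0 1 z 0) in Hz1.
    - rewrite 2!Hz in Hz1; lra.
    - lra.
    - cont1; [|now apply (continuity_2d_pt_fst (ext u))..].
      apply (continuous_RInt_param (fun s y => ext ut y s)); [exact Hr|].
      apply filter_forall; intros; now apply continuity_2d_pt_swap.
    - intros y Hy; rewrite (is_RInt_derive_interior (ext u y)); [simpl; ring|exact Hr|..];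
        intros s Hs; [apply Hdt; lra|now apply continuity_2d_pt_snd..]. }
  assert (H0 : forall t, t0 < t -> ext ut z t = 0).
  { intros t Ht.
    assert (D : is_derive (RInt (ext ut z) t0) t (ext ut z t))
      by (apply is_derive_RInt_upper; intros; now apply continuity_2d_pt_snd).
    rewrite <- (is_derive_unique _ _ _ D).
    apply is_derive_unique, is_derive_ext_loc with (fun _ => 0);
      [|apply (is_derive_const (V := R_NormedModule))].
    apply (locally_gt t0); [exact Ht|]; intros s Hs; symmetry; apply HI; lra. }
  assert (H1 : ext ut z t0 = 0).
  { apply (continuous_eq_closure (ext ut z) t0 (t0 + 1)); [lra|lra| |].
    - now apply continuity_2d_pt_snd.
    - intros y Hy; apply H0; lra. }
  intros t; destruct (Rle_lt_dec t t0) as [Ht|Ht]; [|now apply H0].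
  rewrite <- H1; unfold ext; rewrite (Rmax_left t0 t), (Rmax_left t0 t0); lra. }
exists (ext u), (ext ux), (ext uxx), (ext ut), Z, uxxt, utt; split.
2:{ intros; split; now apply Hext. }
split.
- intros x t; auto.
- intros t; destruct (HbU t); repeat split; auto; apply HbW; try lra; intros; apply HbU.
- intros x t Hx Ht; destruct (Req_dec t t0) as [->|Hne].
  + split; apply is_derive_initial_slice; auto; intros; now apply Hdx.
  + apply Hdx; lra.
- intros x t Hx Ht; destruct (Hdt x t Hx Ht) as (D1 & D2 & D3).
  exact (conj D1 (conj (proj1 (HZ x t Hx Ht)) (conj D2 D3))).
- intros x t Hx Ht; destruct (HZ x t Hx Ht) as (D1 & D2 & D3 & _); exact (conj D2 D3).
- intros x t Hx Ht; destruct (Hci' x t Hx Ht); destruct (HZ x t Hx Ht) as (_ & _ & _ & D).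
  auto.
- intros x t Hx Ht; rewrite !Hext by lra; now apply Heq.
Qed.

(** * Decay *)

(** The derivative of [c y^2 / 2 - int_0^y f] is [(c - f'(s)) y] for some [s] between [0] and [y],
    and [y] has the sign of [z]. Bounding [f'] only for [|s| <= |z|] matters for the lower bound,
    since [F'] is bounded below only locally. *)
Lemma primitive_le_quadratic (f f' : R -> R) (c z : R) :
  (forall s, is_derive f s (f' s)) -> f 0 = 0 ->
  (forall s, Rabs s <= Rabs z -> f' s <= c) -> RInt f 0 z <= c / 2 * (z * z).
Proof.
intros Hf Hf0 Hc.
assert (Hfc : forall s, continuous f s) by (intros; eapply is_derive_continuous, Hf).
destruct (MVT_gen (fun y => c / 2 * (y * y) - RInt f 0 y) 0 z (fun y => c * y - f y))
  as (y & Hy & E).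
- intros y _; evar_last.
  + apply is_derive_Rminus; [|apply is_derive_RInt_upper, Hfc].
    apply is_derive_Rscal, (is_derive_Rmult (fun y => y) (fun y => y)); apply is_derive_id.
  + unfold one; simpl; field.
- intros y _; apply continuity_pt_filterlim.
  apply (continuous_Rminus (fun y => c / 2 * (y * y)) (RInt f 0)); [cont1; apply continuous_id|].
  apply (is_derive_continuous (RInt f 0) y (f y)), is_derive_RInt_upper, Hfc.
- destruct (MVT_gen f 0 y f') as (s & Hs & E2).
  + intros; apply Hf.
  + intros; apply continuity_pt_filterlim, Hfc.
  + rewrite RInt_point in E; unfold zero in E; simpl in E.
    assert (Hs' : f' s <= c).
    { apply Hc; unfold Rmin, Rmax in Hs, Hy; revert Hs Hy.
      repeat destruct Rle_dec; unfold Rabs; repeat destruct Rcase_abs; lra. }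
    assert (Hyz : 0 <= y * z).
    { unfold Rmin, Rmax in Hy; destruct Rle_dec; nra. }
    rewrite Hf0, Rminus_0_r, Rminus_0_r in E2; rewrite E2 in E.
    assert (0 <= (c - f' s) * (y * z)) by (apply Rmult_le_pos; lra).
    nra.
Qed.

Lemma primitive_ge_quadratic (f f' : R -> R) (c z : R) :
  (forall s, is_derive f s (f' s)) -> f 0 = 0 ->
  (forall s, Rabs s <= Rabs z -> - c <= f' s) -> - RInt f 0 z <= c / 2 * (z * z).
Proof.
intros Hf Hf0 Hc.
replace (- RInt f 0 z) with (RInt (fun s => - f s) 0 z).
- apply (primitive_le_quadratic (fun s => - f s) (fun s => - f' s)).
  + intros s; apply (is_derive_opp (V := R_NormedModule) f), Hf.
  + rewrite Hf0; ring.
  + intros s Hs; specialize (Hc s Hs); lra.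
- apply (RInt_opp (V := R_CompleteNormedModule) f 0 z).
  apply (ex_RInt_continuous (V := R_CompleteNormedModule)); intros.
  eapply is_derive_continuous, Hf.
Qed.

Lemma cont_within_continuous (D : R -> Prop) (f : R -> R) (x : R) :
  continuous f x -> cont_within D f x.
Proof. apply filterlim_filter_le_1, filter_le_within. Qed.

(** [Derive] may be meaningless at 0 and 1, but the integral only sees the open interval, on which
    it agrees with the derivatives of the extended functions. *)
Lemma dGamma_slice (phi psi u v w z : R -> R) :
  (forall x, 0 < x < 1 -> phi x = u x /\ psi x = z x) ->
  (forall x, 0 < x < 1 -> is_derive u x (v x) /\ is_derive v x (w x)) ->
  dGamma phi psi = sqrt (RInt (fun x => u x * u x + v x * v x + w x * w x + z x * z x) 0 1).
Proof.
intros He Hd; unfold dGamma; f_equal; apply RInt_ext.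
rewrite Rmin_left, Rmax_right by lra; intros x Hx.
assert (D1 : forall y, 0 < y < 1 -> Derive phi y = v y).
{ intros y Hy; apply is_derive_unique, is_derive_ext_loc with u; [|now apply Hd].
  apply (locally_open_interval 0 1); [exact Hy|]; intros s Hs; symmetry; now apply He. }
assert (D2 : Derive (Derive phi) x = w x).
{ apply is_derive_unique, is_derive_ext_loc with v; [|now apply Hd].
  apply (locally_open_interval 0 1); [exact Hx|]; intros s Hs; symmetry; now apply D1. }
destruct (He x Hx) as [-> ->]; rewrite D2, D1 by exact Hx; simpl; ring.
Qed.

(** [p] is the logarithmic derivative of [cos (k (x - 1/2))], which is positive on [[0,1]] precisely
    because [k < PI]. *)
Lemma log_derivative_cos (k : R) : 0 < k < PI ->
  exists p : R -> R, forall x, 0 <= x <= 1 -> is_derive p x (- (k * k + p x * p x)).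
Proof.
intros Hk; exists (fun x => - k * (sin (k * (x - / 2)) / cos (k * (x - / 2)))).
intros x Hx.
assert (Hcos : 0 < cos (k * (x - / 2))) by (apply cos_gt_0; nra).
unfold Rminus in Hcos.
auto_derive; [repeat split; lra|]; unfold Rminus; field; lra.
Qed.

(** Completing the square in [y] costs [eps / (4 kap) al^2 z^2]. With [q = al + e >= e + m > 0],
    both [al^2 <= q^2 + e^2] and the constant [1 + e] are bounded by multiples of [q], so [g q]
    dominates them. The multiple for [al^2] is linear in [b]. *)
Lemma quadratic_absorption (eps kap e m b al g y z : R) :
  0 < eps -> 0 < kap -> 0 < e -> 0 < e + m -> m <= al <= b ->
  eps / (4 * kap) * (b + e + e * e / (e + m)) + (e + 1) / (e + m) <= g ->
  eps * al * y * z - (al + g * (al + e)) * (z * z) <= eps * kap * (y * y) - z * z.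
Proof.
intros Heps Hkap He Hnu Hal Hg.
set (nu := e + m) in *.
set (q := al + e).
assert (Hq : nu <= q) by (unfold nu, q; lra).
assert (Hq2 : al * al <= (b + e + e * e / nu) * q).
{ assert (e * e <= e * e / nu * q).
  { apply Rle_trans with (e * e / nu * nu); [right; field; lra|].
    apply Rmult_le_compat_l; [apply Rlt_le, Rdiv_lt_0_compat; nra|exact Hq]. }
  assert (q * q <= (b + e) * q) by (apply Rmult_le_compat_r; unfold q in *; lra).
  assert (al * al <= q * q + e * e) by (unfold q in *; nra).
  lra. }
assert (H1 : 1 + e <= (e + 1) / nu * q).
{ apply Rle_trans with ((e + 1) / nu * nu); [right; field; lra|].
  apply Rmult_le_compat_l; [apply Rlt_le, Rdiv_lt_0_compat; lra|exact Hq]. }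
assert (Hk : 0 < eps / (4 * kap)) by (apply Rdiv_lt_0_compat; lra).
assert (Hcoef : eps / (4 * kap) * (al * al) + 1 - al - g * q <= 0).
{ assert (eps / (4 * kap) * (al * al) <= eps / (4 * kap) * ((b + e + e * e / nu) * q))
    by (apply Rmult_le_compat_l; lra).
  assert ((eps / (4 * kap) * (b + e + e * e / nu) + (e + 1) / nu) * q <= g * q)
    by (apply Rmult_le_compat_r; lra).
  unfold q in *; lra. }
assert (Hz : (eps / (4 * kap) * (al * al) + 1 - al - g * q) * (z * z) <= 0)
  by (pose proof (Rle_0_sqr z) as Hz2; unfold Rsqr in Hz2; nra).
assert (Hsq : 0 <= eps * kap * ((y - al * z / (2 * kap)) * (y - al * z / (2 * kap)))).
{ apply Rmult_le_pos; [nra|apply Rle_0_sqr]. }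
replace (eps * kap * ((y - al * z / (2 * kap)) * (y - al * z / (2 * kap))))
  with (eps * kap * (y * y) - eps * al * y * z + eps / (4 * kap) * (al * al) * (z * z))
  in Hsq by (field; lra).
unfold q in *; lra.
Qed.

(** [s = (N + 1)^(1 / (2 - tau))] solves [s^2 = (N + 1) s^tau], and [s^tau >= 1] lets the constant
    [c2] be absorbed. *)
Lemma superlinear_choice (tau n c1 c2 : R) :
  tau < 2 -> 0 <= tau -> 0 <= n -> 0 <= c1 -> 0 <= c2 ->
  exists s, 1 <= s /\ n * (c1 * Rpower s tau + c2) < s * s.
Proof.
intros Htau Htau0 Hn H1 H2.
pose (N := n * (c1 + c2)).
assert (HN : 0 <= N) by (apply Rmult_le_pos; lra).
pose (s := Rpower (N + 1) (/ (2 - tau))).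
assert (Hi : 0 < / (2 - tau)) by (apply Rinv_0_lt_compat; lra).
assert (Hs : 1 <= s).
{ apply Rle_trans with (Rpower (N + 1) 0); [rewrite Rpower_O; lra|apply Rle_Rpower; lra]. }
assert (Ht : 1 <= Rpower s tau).
{ apply Rle_trans with (Rpower s 0); [rewrite Rpower_O; lra|apply Rle_Rpower; lra]. }
exists s; split; [exact Hs|].
assert (E : s * s = Rpower s tau * (N + 1)).
{ replace (N + 1) with (Rpower s (2 - tau)).
  - rewrite <- Rpower_plus; replace (tau + (2 - tau)) with (1 + 1) by ring.
    rewrite Rpower_plus, Rpower_1; lra.
  - unfold s; rewrite Rpower_mult, Rinv_l, Rpower_1; lra. }
rewrite E.
assert (n * (c1 * Rpower s tau + c2) <= N * Rpower s tau).
{ unfold N; replace (n * (c1 + c2) * Rpower s tau)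
    with (n * (c1 * Rpower s tau + c2 * Rpower s tau)) by ring.
  apply Rmult_le_compat_l; [exact Hn|]; nra. }
lra.
Qed.

Lemma rpow_le_Rpower (d s tau : R) :
  0 <= tau -> 0 <= d <= s -> 1 <= s -> rpow d tau <= Rpower s tau.
Proof.
intros Htau Hd Hs; unfold rpow.
assert (0 < Rpower s tau) by apply exp_pos.
destruct (Req_EM_T d 0); [destruct (Req_EM_T tau 0) as [->|]; [rewrite Rpower_O|]; lra|].
apply Rle_Rpower_l; lra.
Qed.

Section Decay.

Variables (eps k K t0 : R) (F F' p : R -> R) (al U P X W Wx Wxx Wt : R -> R -> R).
Hypothesis (flow : strong_flow eps F al t0 U P X W Wx Wxx Wt).
Hypothesis (eps_pos : 0 < eps).
Hypothesis (F_der : forall z, is_derive F z (F' z)).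
Hypothesis (F'_cont : forall z, continuous F' z).
Hypothesis (F_0 : F 0 = 0).
Hypothesis (F'_le : forall z, F' z <= K).
Hypothesis (K_pos : 0 < K).
Hypothesis (k_pos : 0 < k).
Hypothesis (K_lt : K < k * k).
Hypothesis (p_der : forall x, 0 <= x <= 1 -> is_derive p x (- (k * k + p x * p x))).
Variable (g : R).
Hypothesis (g_ge : 1 <= g).

(** The fraction of [eps int u_xx^2] left after the source term has taken [K / k^2] of it. Half of
    it serves to absorb [eps a u_xx w], the other half gives the decay. *)
Definition margin := 1 - K / (k * k).
Definition poincare_constant := 1 + / (k * k) + / (k * k) * / (k * k).
Definition sqr_norm (t : R) : R :=
  RInt (fun x => U x t * U x t + P x t * P x t + X x t * X x t + W x t * W x t) 0 1.
Definition energy (t : R) : R := RInt (fun x => lyapunov_density eps F U P X W g x t) 0 1.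
Definition dissipation (t : R) : R :=
  RInt (fun x => dissipation_density eps F U X W (margin / 2) x t) 0 1.

Let cU t x : continuous (fun y => U y t) x.
Proof. apply (continuity_2d_pt_fst U), (sf_cont _ _ _ _ _ _ _ _ _ _ _ flow). Qed.
Let cP t x : continuous (fun y => P y t) x.
Proof. apply (continuity_2d_pt_fst P), (sf_cont _ _ _ _ _ _ _ _ _ _ _ flow). Qed.
Let cX t x : continuous (fun y => X y t) x.
Proof. apply (continuity_2d_pt_fst X), (sf_cont _ _ _ _ _ _ _ _ _ _ _ flow). Qed.
Let cW t x : continuous (fun y => W y t) x.
Proof. apply (continuity_2d_pt_fst W), (sf_cont _ _ _ _ _ _ _ _ _ _ _ flow). Qed.
Let cF z : continuous F z.
Proof. eapply is_derive_continuous, F_der. Qed.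
Let cFU t x : continuous (fun y => F (U y t)) x.
Proof. apply (continuous_comp (fun y => U y t) F); auto. Qed.
Let cPhi t x : continuous (fun y => RInt F 0 (U y t)) x.
Proof.
apply (continuous_comp (fun y => U y t) (RInt F 0)); auto.
eapply is_derive_continuous, is_derive_RInt_upper, cF.
Qed.

Lemma sqr_norm_split (t : R) : sqr_norm t =
  RInt (fun x => U x t * U x t) 0 1 + RInt (fun x => P x t * P x t) 0 1
  + RInt (fun x => X x t * X x t) 0 1 + RInt (fun x => W x t * W x t) 0 1.
Proof. unfold sqr_norm; rewrite !RInt_Rplus by exr; reflexivity. Qed.

Lemma RInt_sqr_ge_0 (f : R -> R -> R) (t : R) :
  (forall x, continuous (fun y => f y t) x) -> 0 <= RInt (fun x => f x t * f x t) 0 1.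
Proof. intros Hf; apply RInt_ge_0; [lra|exr|]; intros x _; apply Rle_0_sqr. Qed.

Lemma margin_pos : 0 < margin.
Proof.
unfold margin; assert (K / (k * k) < 1); [|lra].
apply Rmult_lt_reg_r with (k * k); [nra|].
replace (K / (k * k) * (k * k)) with K by (field; lra); lra.
Qed.

Lemma slice_bounds (t : R) : t0 <= t ->
  k * k * RInt (fun x => U x t * U x t) 0 1 <= RInt (fun x => P x t * P x t) 0 1 /\
  k * k * RInt (fun x => P x t * P x t) 0 1 <= RInt (fun x => X x t * X x t) 0 1 /\
  RInt (fun x => - (X x t * F (U x t))) 0 1 <= K * RInt (fun x => P x t * P x t) 0 1 /\
  (forall x, 0 <= x <= 1 -> U x t * U x t <= sqr_norm t).
Proof.
intros Ht.
destruct (sf_bdry _ _ _ _ _ _ _ _ _ _ _ flow t) as (HU0 & HU1 & _).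
assert (D1 := fun x Hx => proj1 (sf_dx _ _ _ _ _ _ _ _ _ _ _ flow x t Hx Ht)).
assert (D2 := fun x Hx => proj2 (sf_dx _ _ _ _ _ _ _ _ _ _ _ flow x t Hx Ht)).
assert (cF'U : forall x, continuous (fun y => F' (U y t)) x).
{ intros x; apply (continuous_comp (fun y => U y t) F'); auto. }
refine (conj _ (conj _ (conj _ _))).
- apply (poincare p k (fun x => U x t) (fun x => P x t)); auto.
- apply (poincare_derivative p k (fun x => U x t) (fun x => P x t) (fun x => X x t)); auto.
- rewrite (RInt_by_parts_slice (fun x => U x t) (fun x => P x t) (fun x => X x t)
    (cU t) (cP t) (cX t) D1 D2 HU0 HU1 F F'); auto.
  rewrite <- RInt_Rscal by exr.
  apply RInt_le; [lra|exr|exr|]; intros x _.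
  apply Rmult_le_compat_r; [apply Rle_0_sqr|apply F'_le].
- intros x Hx.
  apply Rle_trans with (RInt (fun y => U y t * U y t + P y t * P y t) 0 1).
  + apply (sqr_le_RInt (fun x => U x t) (fun x => P x t)); auto.
  + rewrite sqr_norm_split, RInt_Rplus by exr.
    pose proof (RInt_sqr_ge_0 X t (cX t)); pose proof (RInt_sqr_ge_0 W t (cW t)); lra.
Qed.

Lemma sqr_norm_le (t : R) : t0 <= t ->
  sqr_norm t <= poincare_constant *
    (RInt (fun x => X x t * X x t) 0 1 + RInt (fun x => W x t * W x t) 0 1).
Proof.
intros Ht; destruct (slice_bounds t Ht) as (H1 & H2 & _); rewrite sqr_norm_split.
pose proof (RInt_sqr_ge_0 W t (cW t)) as H3.
unfold poincare_constant.
assert (Hi : 0 < / (k * k)) by (apply Rinv_0_lt_compat; nra).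
assert (Alg : forall a b c w, k * k * a <= b -> k * k * b <= c -> 0 <= w ->
  a + b + c + w <= (1 + / (k * k) + / (k * k) * / (k * k)) * (c + w)).
{ intros a b c w Ha Hb Hw.
  assert (b <= / (k * k) * c).
  { replace b with (/ (k * k) * (k * k * b)) by (field; lra).
    apply Rmult_le_compat_l; lra. }
  assert (a <= / (k * k) * b).
  { replace a with (/ (k * k) * (k * k * a)) by (field; lra).
    apply Rmult_le_compat_l; lra. }
  assert (/ (k * k) * b <= / (k * k) * (/ (k * k) * c)) by (apply Rmult_le_compat_l; lra).
  assert (0 <= / (k * k) * w) by (apply Rmult_le_pos; lra).
  assert (0 <= / (k * k) * (/ (k * k) * w)) by (apply Rmult_le_pos; lra).
  lra. }
now apply Alg.
Qed.

Lemma poincare_constant_pos : 0 < poincare_constant.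
Proof.
unfold poincare_constant.
assert (Hi : 0 < / (k * k)) by (apply Rinv_0_lt_compat; nra); nra.
Qed.

Definition dissipation_rate := Rmin (eps * margin / 2) 1 / poincare_constant.

Lemma dissipation_rate_pos : 0 < dissipation_rate.
Proof.
apply Rdiv_lt_0_compat; [|apply poincare_constant_pos].
pose proof margin_pos; apply Rmin_glb_lt; nra.
Qed.

Lemma Rmin_combination (c1 c2 x w d : R) :
  0 <= x -> 0 <= w -> 0 < c1 -> 0 < c2 -> d <= poincare_constant * (x + w) ->
  Rmin c1 c2 / poincare_constant * d <= c1 * x + c2 * w.
Proof.
intros Hx Hw H1 H2 Hd; pose proof poincare_constant_pos as HL.
pose proof (Rmin_l c1 c2); pose proof (Rmin_r c1 c2).
assert (Hm : 0 < Rmin c1 c2) by (apply Rmin_glb_lt; lra).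
apply Rle_trans with (Rmin c1 c2 / poincare_constant * (poincare_constant * (x + w))).
- apply Rmult_le_compat_l; [apply Rlt_le, Rdiv_lt_0_compat|]; assumption.
- replace (Rmin c1 c2 / poincare_constant * (poincare_constant * (x + w)))
    with (Rmin c1 c2 * x + Rmin c1 c2 * w) by (field; lra).
  apply Rplus_le_compat; apply Rmult_le_compat_r; assumption.
Qed.

(** Integration by parts gives [- int u_xx F(u) = int F'(u) u_x^2 <= K int u_x^2 <= (K / k^2) int
    u_xx^2]. *)
Lemma dissipation_le (t : R) : t0 <= t -> dissipation t <= - dissipation_rate * sqr_norm t.
Proof.
intros Ht; destruct (slice_bounds t Ht) as (H1 & H2 & H3 & _).
pose proof (sqr_norm_le t Ht) as Hd.
pose proof (RInt_sqr_ge_0 W t (cW t)) as HW; pose proof (RInt_sqr_ge_0 X t (cX t)) as HX.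
pose proof margin_pos as Hm.
assert (E : dissipation t = - eps * (1 - margin / 2) * RInt (fun x => X x t * X x t) 0 1
  + eps * RInt (fun x => - (X x t * F (U x t))) 0 1 - RInt (fun x => W x t * W x t) 0 1).
{ unfold dissipation, dissipation_density.
  rewrite <- !RInt_Rscal, <- RInt_Rplus, <- RInt_Rminus by exr.
  apply RInt_ext; intros; simpl; ring. }
rewrite E.
pose proof (Rmin_combination (eps * margin / 2) 1 _ _ _ HX HW ltac:(nra) Rlt_0_1 Hd) as Hc.
fold dissipation_rate in Hc.
assert (Alg : forall a b c : R, k * k * b <= c -> a <= K * b ->
  eps * a <= eps * (1 - margin) * c).
{ intros a b c Hb Ha.
  replace (eps * (1 - margin) * c) with (eps * (K / (k * k) * c)) by (unfold margin; ring).
  apply Rmult_le_compat_l; [lra|].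
  apply Rle_trans with (K * b); [exact Ha|].
  replace (K * b) with (K / (k * k) * (k * k * b)) by (field; lra).
  apply Rmult_le_compat_l; [apply Rlt_le, Rdiv_lt_0_compat; nra|exact Hb]. }
specialize (Alg _ _ _ H2 H3); lra.
Qed.

(** Free of [g]: only [g >= 1] is used in the lower bound of the energy, so enlarging [g] does not
    spoil it. *)
Definition coercivity := Rmin (eps * eps / 8) (/ 4) / poincare_constant.

Lemma coercivity_pos : 0 < coercivity.
Proof.
apply Rdiv_lt_0_compat; [|apply poincare_constant_pos]; apply Rmin_glb_lt; nra.
Qed.

Lemma energy_ge (t : R) : t0 <= t -> coercivity * sqr_norm t <= energy t.
Proof.
intros Ht; destruct (slice_bounds t Ht) as (H1 & H2 & _).
pose proof (sqr_norm_le t Ht) as Hd.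
pose proof (RInt_sqr_ge_0 W t (cW t)) as HW; pose proof (RInt_sqr_ge_0 X t (cX t)) as HX.
pose proof (RInt_sqr_ge_0 U t (cU t)) as HU.
pose proof (Rmin_combination (eps * eps / 8) (/ 4) _ _ _ HX HW ltac:(nra) ltac:(lra) Hd) as Hc.
fold coercivity in Hc.
apply Rle_trans with (1 := Hc).
apply Rle_trans with (eps * eps / 8 * RInt (fun x => X x t * X x t) 0 1
  + / 4 * RInt (fun x => W x t * W x t) 0 1
  + (1 + g) / 2 * (RInt (fun x => P x t * P x t) 0 1 - K * RInt (fun x => U x t * U x t) 0 1)).
{ assert (Alg : forall a b : R, k * k * a <= b -> 0 <= a -> 0 <= (1 + g) / 2 * (b - K * a)).
  { intros a b Hab Ha; apply Rmult_le_pos; [lra|]; nra. }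
  specialize (Alg _ _ H1 HU); lra. }
unfold energy, lyapunov_density.
rewrite <- !RInt_Rscal, <- RInt_Rminus, <- RInt_Rscal, <- !RInt_Rplus by exr.
apply RInt_le; [lra|exr|exr|]; intros x _.
assert (HPhi : RInt F 0 (U x t) <= K / 2 * (U x t * U x t))
  by (apply (primitive_le_quadratic F F'); auto).
assert (Hq : 0 <= (eps * X x t / 2 - W x t) * (eps * X x t / 2 - W x t)) by apply Rle_0_sqr.
(* For [g = 1] the quadratic part in [X], [W] exceeds [eps^2 X^2 / 8 + W^2 / 4] by
   [(3 eps X - 4 W)^2 / 24 + W^2 / 12]; [Hq3] accounts for larger [g]. *)
assert (Hq1 : 0 <= (3 * (eps * X x t) - 4 * W x t) * (3 * (eps * X x t) - 4 * W x t))
  by apply Rle_0_sqr.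
assert (Hq2 : 0 <= W x t * W x t) by apply Rle_0_sqr.
assert (Hq3 : 0 <= (g - 1) * (W x t * W x t)) by (apply Rmult_le_pos; lra).
assert (Hq4 : (1 + g) * RInt F 0 (U x t) <= (1 + g) * (K / 2 * (U x t * U x t)))
  by (apply Rmult_le_compat_l; lra).
simpl; nra.
Qed.

(** A common majorant of the coefficients [eps^2], [1 + g / 2], [(1 + g) / 2] and [(1 + g) M / 2] of
    the four squares; what matters is that it is linear in [1 + g]. *)
Definition energy_constant (M : R) := (1 + g) * (eps * eps + 2 + M).

Lemma energy_le (r M t : R) :
  t0 <= t -> 0 <= r -> 0 <= M -> (forall s, Rabs s <= r -> - M <= F' s) ->
  sqr_norm t <= r * r -> energy t <= energy_constant M * sqr_norm t.
Proof.
intros Ht Hr HM HF' Hd.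
destruct (slice_bounds t Ht) as (_ & _ & _ & Hsup).
unfold energy, lyapunov_density, sqr_norm.
rewrite <- RInt_Rscal by exr.
apply RInt_le; [lra|exr|exr|]; intros x Hx.
assert (HPhi : - RInt F 0 (U x t) <= M / 2 * (U x t * U x t)).
{ apply (primitive_ge_quadratic F F'); auto; intros s Hs; apply HF'.
  apply Rle_trans with (1 := Hs); 
  assert (HU : U x t * U x t <= r * r) by (apply Rle_trans with (sqr_norm t); [apply Hsup; lra|exact Hd]).
  apply Rsqr_incr_0_var; [|exact Hr]; rewrite <- Rsqr_abs; exact HU. }
assert (HP1 : (1 + g) * - RInt F 0 (U x t) <= (1 + g) * (M / 2 * (U x t * U x t)))
  by (apply Rmult_le_compat_l; lra).
assert (Hs1 : 0 <= (eps * X x t + W x t) * (eps * X x t + W x t)) by apply Rle_0_sqr.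
assert (HXX : 0 <= X x t * X x t) by apply Rle_0_sqr.
assert (HWW : 0 <= W x t * W x t) by apply Rle_0_sqr.
assert (HUU : 0 <= U x t * U x t) by apply Rle_0_sqr.
assert (HPP : 0 <= P x t * P x t) by apply Rle_0_sqr.
assert (He : 0 < eps * eps) by nra.
assert (HgM : 0 <= g * M) by (apply Rmult_le_pos; lra).
assert (Hge : 0 <= g * (eps * eps)) by (apply Rmult_le_pos; lra).
set (Cst := energy_constant M).
assert (HC : eps * eps <= Cst /\ 1 + g / 2 <= Cst /\ (1 + g) / 2 <= Cst /\ (1 + g) * M / 2 <= Cst).
{ unfold Cst, energy_constant; repeat split; nra. }
destruct HC as (C1 & C2 & C3 & C4).
pose proof (Rmult_le_compat_r _ _ _ HXX C1); pose proof (Rmult_le_compat_r _ _ _ HWW C2).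
pose proof (Rmult_le_compat_r _ _ _ HPP C3); pose proof (Rmult_le_compat_r _ _ _ HUU C4).
lra.
Qed.

Lemma continuous_slice_integral (f : R -> R -> R) :
  (forall x t, continuity_2d_pt f x t) ->
  forall t, continuous (fun t => RInt (fun x => f x t) 0 1) t.
Proof.
intros Hf t; apply continuous_RInt_param; [lra|]; apply filter_forall; intros; apply Hf.
Qed.

Lemma continuous_sqr_norm (t : R) : continuous sqr_norm t.
Proof.
apply (continuous_slice_integral
  (fun x t => U x t * U x t + P x t * P x t + X x t * X x t + W x t * W x t)).
intros x s; destruct (sf_cont _ _ _ _ _ _ _ _ _ _ _ flow x s) as (HU & HP & HX & HW).
cont2; assumption.
Qed.

Lemma continuous_energy (t : R) : continuous energy t.
Proof.
apply (continuous_slice_integral (lyapunov_density eps F U P X W g)).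
intros; eapply continuity_lyapunov_density; eauto.
Qed.

Lemma continuous_dissipation (t : R) : continuous dissipation t.
Proof.
apply (continuous_slice_integral (dissipation_density eps F U X W (margin / 2))).
intros; eapply continuity_dissipation_density; eauto.
Qed.

(** * Decay below the threshold [sigma], and its continuation to all times *)

Variables (alpha sigma M1 M2 : R).
Hypothesis (alpha_ge : 0 <= alpha).
Hypothesis (sigma_ge : 0 <= sigma).
Hypothesis (M1_ge : 0 <= M1).
Hypothesis (M2_ge : 0 <= M2).
Hypothesis (F'_alpha : forall s, Rabs s <= alpha -> - M1 <= F' s).
Hypothesis (F'_sigma : forall s, Rabs s <= sigma -> - M2 <= F' s).
Hypothesis (sigma_large : energy_constant M1 / coercivity * (alpha * alpha) < sigma * sigma).
Hypothesis (alpha_lt_sigma : alpha * alpha < sigma * sigma).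
Hypothesis (initial : sqr_norm t0 <= alpha * alpha).
Hypothesis (absorb : forall x r y z, 0 < x < 1 -> t0 < r -> sqr_norm r <= sigma * sigma ->
    eps * al x r * y * z - (al x r + g * (al x r + eps * (k * k))) * (z * z)
    <= eps * (margin / 2) * (y * y) - z * z).

Let rate := dissipation_rate / energy_constant M2.

(** The energy is compared with [sqr_norm] from above twice: at [t0], where [alpha] bounds the norm
    and [M1] suffices, and at later times, where [sigma] does and [M2] is needed. So [M2] enters
    [rate] but not the prefactor. *)
Lemma decay_while_bounded (T : R) : t0 <= T ->
  (forall r, t0 <= r <= T -> sqr_norm r <= sigma * sigma) ->
  sqr_norm T <= energy_constant M1 / coercivity * exp (- rate * (T - t0)) * sqr_norm t0.
Proof.
intros HT Hb.
assert (HC2 : 0 < energy_constant M2) by (unfold energy_constant; nra).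
assert (HC1 : 0 < energy_constant M1) by (unfold energy_constant; nra).
pose proof dissipation_rate_pos as Hr; pose proof coercivity_pos as Hco.
assert (Hrate : 0 < rate) by (apply Rdiv_lt_0_compat; assumption).
assert (HV : energy T <= exp (- rate * (T - t0)) * energy t0).
{ apply gronwall_backward; auto; [apply continuous_energy|].
  intros s Hs HsT.
  assert (E := energy_inequality eps k t0 F p al U P X W Wx Wxx Wt flow eps_pos cF p_der
    g (margin / 2) ltac:(lra) s T Hs HsT).
  fold (energy T) (energy s) in E.
  assert (Hint : RInt (fun r => RInt (fun x => dissipation_density eps F U X W (margin / 2) x r) 0 1) s T
    <= RInt (fun r => - rate * energy r) s T).
  { apply RInt_le; [exact HsT| | |].
    - apply ex_RInt_cont; [exact HsT|]; intros; apply continuous_dissipation.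
    - apply ex_RInt_cont; [exact HsT|]; intros; cont1; apply continuous_energy.
    - intros r Hr'; fold (dissipation r).
      apply Rle_trans with (- dissipation_rate * sqr_norm r); [apply dissipation_le; lra|].
      assert (HE : energy r <= energy_constant M2 * sqr_norm r)
        by (apply (energy_le sigma); auto; [lra|apply Hb; lra]).
      assert (rate * energy r <= rate * (energy_constant M2 * sqr_norm r))
        by (apply Rmult_le_compat_l; lra).
      replace (rate * (energy_constant M2 * sqr_norm r)) with (dissipation_rate * sqr_norm r)
        in H by (unfold rate; field; lra).
      lra. }
  rewrite RInt_Rscal in Hint
    by (apply ex_RInt_cont; [exact HsT|]; intros; apply continuous_energy).
  specialize (E ltac:(intros x r y z Hx Hr'; apply absorb; [exact Hx|lra|apply Hb; lra])).
  lra. }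
assert (HV0 : energy t0 <= energy_constant M1 * sqr_norm t0)
  by (apply (energy_le alpha); auto; lra).
pose proof (energy_ge T HT) as HVT.
pose proof (exp_pos (- rate * (T - t0))) as Hexp.
apply Rmult_le_reg_l with coercivity; [exact Hco|].
replace (coercivity * (energy_constant M1 / coercivity * exp (- rate * (T - t0)) * sqr_norm t0))
  with (exp (- rate * (T - t0)) * (energy_constant M1 * sqr_norm t0)) by (field; lra).
apply Rle_trans with (1 := HVT), Rle_trans with (1 := HV).
apply Rmult_le_compat_l; lra.
Qed.

Lemma sqr_norm_ge_0 (t : R) : 0 <= sqr_norm t.
Proof.
rewrite sqr_norm_split.
pose proof (RInt_sqr_ge_0 U t (cU t)); pose proof (RInt_sqr_ge_0 P t (cP t)).
pose proof (RInt_sqr_ge_0 X t (cX t)); pose proof (RInt_sqr_ge_0 W t (cW t)); lra.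
Qed.

(** While the norm stays below [sigma], the exponential is at most 1 and the estimate improves the
    bound to [energy_constant M1 / coercivity * alpha^2], strictly less than [sigma^2]; the
    bootstrap applies. *)
Lemma global_decay (t : R) : t0 <= t ->
  sqr_norm t <= energy_constant M1 / coercivity * exp (- rate * (t - t0)) * sqr_norm t0.
Proof.
intros Ht; apply decay_while_bounded; [exact Ht|].
intros r Hr; left; revert r Hr.
assert (Hall : forall r, t0 <= r -> sqr_norm r < sigma * sigma).
{ apply (continuous_bootstrap sqr_norm t0); [apply continuous_sqr_norm|lra|].
  intros r Hr Hb; apply Rle_lt_trans with (2 := sigma_large).
  apply Rle_trans with (1 := decay_while_bounded r Hr Hb).
  assert (HC2 : 0 < energy_constant M2) by (unfold energy_constant; nra).
  assert (HC1 : 0 < energy_constant M1) by (unfold energy_constant; nra).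
  pose proof coercivity_pos as Hco.
  assert (Hrate : 0 < rate) by (apply Rdiv_lt_0_compat; [apply dissipation_rate_pos|assumption]).
  assert (Hq : 0 < energy_constant M1 / coercivity) by (apply Rdiv_lt_0_compat; assumption).
  assert (He : exp (- rate * (r - t0)) <= 1).
  { destruct (Req_dec r t0) as [->|Hne].
    - replace (- rate * (t0 - t0)) with 0 by ring; rewrite exp_0; lra.
    - left; rewrite <- exp_0; apply exp_increasing; nra. }
  pose proof (exp_pos (- rate * (r - t0))); pose proof (sqr_norm_ge_0 t0).
  rewrite Rmult_assoc; apply Rmult_le_compat_l; [lra|]; nra. }
intros r [Hr _]; now apply Hall.
Qed.

End Decay.

(** * Choice of the constants and conclusion *)

Lemma continuous_lower_bound (f : R -> R) (r : R) :
  0 <= r -> (forall x, continuous f x) ->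
  exists M, 0 <= M /\ forall s, Rabs s <= r -> - M <= f s.
Proof.
intros Hr Hf.
destruct (continuity_ab_min f (- r) r) as (x & Hx & _).
- lra.
- intros c _; apply continuity_pt_filterlim, Hf.
- exists (Rabs (f x)); split; [apply Rabs_pos|]; intros s Hs.
  apply Rabs_le_between, Hx in Hs.
  pose proof (Rle_abs (- f x)) as H; rewrite Rabs_Ropp in H; lra.
Qed.

(** The growth bound on [a] is assumed for pairs in [Gamma] only, so every time slice has to be
    shown to lie there. *)
Lemma InGamma_flow (eps : R) (F : R -> R) (al : R -> R -> R) (t0 : R)
    (U P X W Wx Wxx Wt : R -> R -> R) (t : R) :
  strong_flow eps F al t0 U P X W Wx Wxx Wt -> t0 <= t ->
  InGamma (fun x => U x t) (fun x => W x t).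
Proof.
intros flow Ht.
destruct (sf_bdry _ _ _ _ _ _ _ _ _ _ _ flow t) as (HU0 & HU1 & HW0 & HW1).
assert (Hc := fun x => sf_cont _ _ _ _ _ _ _ _ _ _ _ flow x t).
refine (conj _ (conj _ (conj HU0 (conj HU1 (conj HW0 HW1))))).
- exists (fun x => P x t), (fun x => X x t); split.
  + intros x Hx; now apply (sf_dx _ _ _ _ _ _ _ _ _ _ _ flow).
  + intros x _; destruct (Hc x) as (HU & HP & HX & _).
    refine (conj _ (conj _ _)); apply cont_within_continuous;
      [apply (continuity_2d_pt_fst U)|apply (continuity_2d_pt_fst P)
      |apply (continuity_2d_pt_fst X)]; assumption.
- intros x _; apply cont_within_continuous, (continuity_2d_pt_fst W), Hc.
Qed.

(** The strict inequalities leave room below [PI^2]: [k^2] is the midpoint between [PI^2] and the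
    larger of [K] and [- m / eps]. *)
Lemma choose_frequency (eps m K : R) :
  0 < eps -> 0 < K -> K < PI * PI -> 0 < eps * (PI * PI) + m ->
  exists k, 0 < k < PI /\ K < k * k /\ 0 < eps * (k * k) + m.
Proof.
intros Heps HK HKpi Hm; pose proof PI_RGT_0 as Hpi.
pose (r := Rmax K (- m / eps)).
assert (Hr1 : K <= r) by apply Rmax_l.
assert (Hr2 : - m / eps <= r) by apply Rmax_r.
assert (Hr3 : r < PI * PI).
{ apply Rmax_lub_lt; [exact HKpi|]; apply Rmult_lt_reg_r with eps; [exact Heps|].
  replace (- m / eps * eps) with (- m) by (field; lra); lra. }
pose (k := sqrt ((r + PI * PI) / 2)).
assert (Hk : k * k = (r + PI * PI) / 2) by (apply sqrt_sqrt; lra).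
assert (Hk0 : 0 < k) by (apply sqrt_lt_R0; lra).
exists k; refine (conj (conj Hk0 _) (conj _ _)); rewrite ?Hk; try lra.
- nra.
- assert (eps * (- m / eps) < eps * ((r + PI * PI) / 2)) by (apply Rmult_lt_compat_l; lra).
  replace (eps * (- m / eps)) with (- m) in H by (field; lra); lra.
Qed.

Theorem theorem2 (eps : R) (F : R -> R) (a : R -> R -> R -> R -> R -> R -> R) :
  0 < eps ->
  (* F in C^1(R), F(0) = 0, F' <= K < 3 pi^2 / 4 *)
  (exists F' : R -> R, (forall s, is_derive F s (F' s)) /\ (forall s, continuous F' s) /\
     exists K, 0 < K /\ K < 3 * PI ^ 2 / 4 /\ forall s, F' s <= K) ->
  F 0 = 0 ->
  (* a continuous on ]0,1[ x [0,oo) x R^4 *)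
  (forall z, a_dom z -> cont_within a_dom (uncurry6 a) z) ->
  (* nu := eps pi^2 + inf a > 0 *)
  (exists m, (forall z, a_dom z -> m <= uncurry6 a z) /\ 0 < eps * PI ^ 2 + m) ->
  (* growth bound on a over Gamma *)
  (exists tau A A', 0 <= tau < 2 /\ 0 < A /\ 0 <= A' /\
     forall x t (phi psi : R -> R), 0 < x < 1 -> 0 <= t -> InGamma phi psi ->
       a x t (phi x) (Derive phi x) (Derive (Derive phi) x) (psi x)
       <= A * rpow (dGamma phi psi) tau + A') ->
  exp_stable_in_large eps F a.
Proof.
intros Heps (F' & HF & HF' & K & HK & HKpi & HFK) HF0 _ (m & Hm & Hnu)
  (tau & A & A' & Htau & HA & HA' & Ha) alpha Halpha.
pose proof PI_RGT_0 as Hpi.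
destruct (choose_frequency eps m K Heps HK) as (k & Hk & HKk & Hek); [nra|nra|].
destruct (log_derivative_cos k Hk) as [p Hp].
destruct (continuous_lower_bound F' alpha ltac:(lra) HF') as (M1 & HM1 & HM1').
assert (Hk0 : 0 < k) by apply Hk.
assert (Hmar : 0 < margin k K) by (apply margin_pos; assumption).
assert (Hco : 0 < coercivity eps k) by (apply (coercivity_pos eps k K); assumption).
assert (Hdr : 0 < dissipation_rate eps k K) by (apply dissipation_rate_pos; assumption).
set (e := eps * (k * k)) in *.
assert (He : 0 < e) by (unfold e; nra).
pose (q := eps / (4 * (margin k K / 2))).
assert (Hq : 0 < q) by (apply Rdiv_lt_0_compat; lra).
assert (Hee : 0 < e * e / (e + m)) by (apply Rdiv_lt_0_compat; nra).
assert (He1 : 0 < (e + 1) / (e + m)) by (apply Rdiv_lt_0_compat; lra).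
(* [n (1 + g)] will equal [D2 alpha^2 + (1 + g) alpha^2], so the single condition
   [n (1 + g) < sigma^2] yields both smallness conditions of the bootstrap. Nothing in [n] depends
   on [sigma] or [g]. *)
pose (n := ((eps * eps + 2 + M1) / coercivity eps k + 1) * (alpha * alpha)).
assert (Hn0 : 0 < (eps * eps + 2 + M1) / coercivity eps k) by (apply Rdiv_lt_0_compat; nra).
assert (Hn : 0 <= n) by (unfold n; nra).
(* Chosen so that [1 + g = q A sigma^tau + c2]: of the final 2, one unit is the summand that ensures
   [g >= 1], the other comes from [1 + g]. *)
pose (c2 := q * (A' + e + e * e / (e + m)) + (e + 1) / (e + m) + 2).
assert (Hc2 : 2 <= c2) by (unfold c2; nra).
destruct (superlinear_choice tau n (q * A) c2) as (sigma & Hs1 & Hs2); try lra; [nra|].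
pose (b := A * Rpower sigma tau + A').
pose (g := q * (b + e + e * e / (e + m)) + (e + 1) / (e + m) + 1).
assert (Hpow : 0 < Rpower sigma tau) by apply exp_pos.
assert (Hb : 0 < b) by (unfold b; nra).
assert (Hg : 1 <= g) by (unfold g; nra).
assert (Hng : n * (1 + g) < sigma * sigma).
{ replace (1 + g) with (q * A * Rpower sigma tau + c2); [exact Hs2|].
  unfold g, c2, b; ring. }
destruct (continuous_lower_bound F' sigma ltac:(lra) HF') as (M2 & HM2 & HM2').
assert (HE1 : 0 < energy_constant eps g M1) by (unfold energy_constant; nra).
assert (HE2 : 0 < energy_constant eps g M2) by (unfold energy_constant; nra).
pose (D2 := energy_constant eps g M1 / coercivity eps k).
assert (HD2 : 0 < D2) by (apply Rdiv_lt_0_compat; assumption).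
pose (rate := dissipation_rate eps k K / energy_constant eps g M2).
assert (Hrate : 0 < rate) by (apply Rdiv_lt_0_compat; assumption).
assert (Hlarge : D2 * (alpha * alpha) < sigma * sigma /\ alpha * alpha < sigma * sigma).
{ assert (E : n * (1 + g) = D2 * (alpha * alpha) + alpha * alpha * (1 + g)).
  { unfold n, D2, energy_constant; field; lra. }
  assert (0 < alpha * alpha) by nra.
  assert (0 < D2 * (alpha * alpha)) by nra.
  split; nra. }
(* The decay is proved for [d^2]; square roots are taken of the prefactor and of the exponential.
   All constants are fixed before [t0] and the data. *)
exists (sqrt D2), (rate / 2); split; [now apply sqrt_lt_R0|split; [lra|]].
intros t0 u0 u1 u ut Ht0 _ Hinit Hsol t Ht.
destruct (flow_of_solution _ _ _ _ _ _ _ _ Hsol) as (U & P & X & W & Wx & Wxx & Wt & flow & Hag).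
assert (Hinitial : forall x, unit_int x -> u x t0 = u0 x /\ ut x t0 = u1 x).
{ destruct Hsol as (? & ? & ? & ? & _ & _ & _ & _ & _ & H); exact H. }
assert (Hdx := sf_dx _ _ _ _ _ _ _ _ _ _ _ flow).
assert (Hnorm0 : dGamma u0 u1 = sqrt (sqr_norm U P X W t0)).
{ apply (dGamma_slice u0 u1 (fun x => U x t0) (fun x => P x t0) (fun x => X x t0)
    (fun x => W x t0)).
  - intros x Hx; destruct (Hag x t0) as [-> ->]; [lra|lra|].
    destruct (Hinitial x) as [-> ->]; [unfold unit_int; lra|auto].
  - intros x Hx; apply Hdx; [exact Hx|lra]. }
assert (Hnorm : forall s, t0 <= s ->
  dGamma (fun x => U x s) (fun x => W x s) = sqrt (sqr_norm U P X W s)).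
{ intros s Hs; apply (dGamma_slice _ _ (fun x => U x s) (fun x => P x s) (fun x => X x s)
    (fun x => W x s)); auto. }
assert (Hnormu : dGamma (fun x => u x t) (fun x => ut x t) = sqrt (sqr_norm U P X W t)).
{ apply (dGamma_slice _ _ (fun x => U x t) (fun x => P x t) (fun x => X x t)
    (fun x => W x t)); [|auto].
  intros x Hx; destruct (Hag x t) as [-> ->]; auto; lra. }
assert (Hnn := sqr_norm_ge_0 _ _ _ _ _ _ _ _ _ _ _ flow).
assert (Hdecay : sqr_norm U P X W t <= D2 * exp (- rate * (t - t0)) * sqr_norm U P X W t0).
{ apply (global_decay eps k K t0 F F' p _ U P X W Wx Wxx Wt flow Heps HF HF' HF0 HFK HK
    Hk0 HKk Hp g Hg alpha sigma M1 M2); auto; try lra; try apply Hlarge.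
  - rewrite Hnorm0 in Hinit.
    rewrite <- (sqrt_sqrt (sqr_norm U P X W t0)) by apply Hnn.
    apply Rmult_le_compat; try apply sqrt_pos; assumption.
  - intros x r y z Hx Hr Hsr; fold e.
    apply (quadratic_absorption eps (margin k K / 2) e m b); try lra.
    + split.
      * apply (Hm (x, r, U x r, P x r, X x r, W x r)); simpl; lra.
      * assert (HaU := Ha x r (fun x => U x r) (fun x => W x r) Hx ltac:(lra)
          (InGamma_flow _ _ _ _ _ _ _ _ _ _ _ r flow ltac:(lra))).
        assert (D1 : forall y, 0 < y < 1 -> Derive (fun x => U x r) y = P y r).
        { intros y' Hy'; apply is_derive_unique, Hdx; [exact Hy'|lra]. }
        assert (DD : Derive (Derive (fun x => U x r)) x = X x r).
        { rewrite (Derive_ext_loc _ (fun x => P x r)).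
          - apply is_derive_unique, Hdx; [exact Hx|lra].
          - apply (locally_open_interval 0 1); auto. }
        rewrite DD, D1 in HaU by exact Hx.
        apply Rle_trans with (1 := HaU); unfold b.
        apply Rplus_le_compat_r, Rmult_le_compat_l; [lra|].
        apply rpow_le_Rpower; [lra| |exact Hs1].
        rewrite Hnorm by lra; split; [apply sqrt_pos|].
        rewrite <- (sqrt_square sigma) by lra; now apply sqrt_le_1_alt.
    + fold q; unfold g; lra. }
rewrite Hnormu, Hnorm0.
apply Rle_trans with (1 := sqrt_le_1_alt _ _ Hdecay).
pose proof (exp_pos (- rate * (t - t0))).
rewrite sqrt_mult, sqrt_mult; try apply Hnn; try lra; [|nra].
right; do 2 f_equal.
replace (- rate * (t - t0)) with (- (rate / 2) * (t - t0) + - (rate / 2) * (t - t0)) by field.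
rewrite exp_plus; apply sqrt_square, Rlt_le, exp_pos.
Qed.
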